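(* Let $r\in\mathbb{N}$. For each $j\in\{1,\ldots,r\}$ let $\Gamma_j\subset \mathrm{PSL}_2(\mathbb{R})$ be a Fuchsian Schottky group with a fixed choice of Schottky data (disks, side-pairings, geodesic sides $s_{j,k}$ and forward intervals $I_{j,k}$, $k\in\mathcal{I}_j$, as described in the context), and let $L_j\subseteq P^1_{\mathbb{R}}$ be the limit set of $\Gamma_j$. Let $G=\mathrm{PSL}_2(\mathbb{R})^r$, $\Gamma=\Gamma_1\times\cdots\times\Gamma_r$, and $\mathbb{Y}=\Gamma\backslash\mathbb{H}^r$. For $j\in\{1,\ldots,r\}$ set $$C_j=\bigcup_{k\in\mathcal{I}_j}\{g\in\mathrm{PSL}_2(\mathbb{R})\mid g(i)\in s_{j,k},\ g(\infty)\in I_{j,k}\},\qquad C_{\mathrm{st},j}=\{g\in C_j\mid g(\infty)\in L_j\},$$ and let $\widehat{C}_j$ and $\widehat{C}_{\mathrm{st},j}$ be the images of $C_j$ and $C_{\mathrm{st},j}$ in $\Gamma_j\backslash\mathrm{PSL}_2(\mathbb{R})$. Set $\widehat{C}=\prod_{j=1}^r\widehat{C}_j\subseteq \Gamma\backslash G$, which is a cross section for the Weyl chamber flow on $\mathbb{Y}$, and set $$C_{\mathrm{st}}=\prod_{j=1}^rC_{\mathrm{st},j}\subseteq G,\qquad \widehat{C}_{\mathrm{st}}=\prod_{j=1}^r\widehat{C}_{\mathrm{st},j}\subseteq\Gamma\backslash G.$$ Then $\widehat{C}_{\mathrm{st}}$ is the strong cross section contained in $\widehat{C}$, and $C_{\mathrm{st}}$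 is a set of representatives for $\widehat{C}_{\mathrm{st}}$.
   Context: Schottky data. $\mathbb{H}=\{z\in\mathbb{C}\mid \operatorname{Im} z>0\}$ is the hyperbolic plane, on which $\mathrm{PSL}_2(\mathbb{R})$ acts by fractional linear transformations; the action extends to $P^1_{\mathbb{R}}=\mathbb{R}\cup\{\infty\}$. A (Fuchsian) Schottky group arises as follows. For $q\in\mathbb{N}$ choose $2q$ pairwise disjoint closed Euclidean disks $\mathcal{D}_1,\mathcal{D}_{-1},\ldots,\mathcal{D}_q,\mathcal{D}_{-q}$ in $\mathbb{C}$ (of positive radius) centered in $\mathbb{R}$. For $k\in\{1,\ldots,q\}$ pick $g_k\in\mathrm{PSL}_2(\mathbb{R})$ mapping the exterior of $\mathcal{D}_k$ (in the Riemann sphere) onto the interior of $\mathcal{D}_{-k}$, and set $g_{-k}=g_k^{-1}$. The Schottky group is $\langle g_1,\ldots,g_q\rangle$. Put $\mathcal{I}=\{\pm1,\ldots,\pm q\}$. For $k\in\mathcal{I}$ let $s_k$ be the boundary of $\mathcal{D}_k$ in $\mathbb{H}$ (a geodesic) and let the forward interval $I_k=P^1_{\mathbb{R}}\setminus\mathcal{D}_k$ be the part of $P^1_{\mathbb{R}}$ exterior to $\mathcal{D}_k$. For the group $\Gamma_j$ all these objects carry an additional index $j$. The limit set $L_j$ is the set of limit points in $P^1_{\mathbb{R}}$ of the orbit $\Gamma_j(z)$, for any $z\in\mathbb{H}$. Weyl chamber flow. $G=\mathrm{PSL}_2(\mathbb{R})^r$ acts componentwise on $\mathbb{X}=\mathbb{H}^r$.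 With origin $(i,\ldots,i)$ let $K=\mathrm{PSO}(2)^r$ be its stabilizer, so $\mathbb{X}=G/K$ and $\mathbb{Y}=\Gamma\backslash G/K$. For $t\in\mathbb{R}$ let $a_t\in\mathrm{PSL}_2(\mathbb{R})$ be the class of $\mathrm{diag}(e^{t/2},e^{-t/2})$; for $t=(t_1,\ldots,t_r)\in\mathbb{R}^r$ put $a_t=(a_{t_1},\ldots,a_{t_r})$, and let $A=\{a_t\mid t\in\mathbb{R}^r\}$. The centralizer $M$ of $A$ in $K$ is trivial, so the Weyl chambers of $\mathbb{X}$ are identified with $G/M=G$ and the Weyl chambers of $\mathbb{Y}$ with $\Gamma\backslash G=\prod_{j=1}^r\Gamma_j\backslash\mathrm{PSL}_2(\mathbb{R})$. The Weyl chamber flow on $\mathbb{Y}$ is the action $(a,\Gamma g)\mapsto\Gamma ga$ of $A$ on $\Gamma\backslash G$. The oriented flats of $\mathbb{Y}$ are the elements $\Gamma gA$ of $\Gamma\backslash G/A$; the underlying flat of $\Gamma gA$ is the subset $\Gamma gAK$ of $\mathbb{Y}$, and the oriented flat is called compact if this subset of $\mathbb{Y}$ is compact. The positive Weyl chamber is $A^+=\{a_t\mid t\in(\mathbb{R}_{>0})^r\}$, and the set of regular elements of $A$ is $A^{\mathrm{reg}}=\{a_t\mid t_j\neq0\ \forall j\}$. Cross sections. For $\widehat{S}\subseteq\Gamma\backslash G$, an oriented flat $\Gamma gA$ intersects $\widehat{S}$ in $\Gamma h\in\widehat{S}$ if $\Gamma hA=\Gamma gA$. The intersection is discrete if there is a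 neighborhood $U$ of the identity in $A$ such that $\Gamma ha\notin\widehat{S}$ for all $a\in U\cap A^{\mathrm{reg}}$. A subset $\widehat{S}\subseteq\Gamma\backslash G$ is a cross section for the Weyl chamber flow on $\mathbb{Y}$ if (C1) every compact oriented flat of $\mathbb{Y}$ intersects $\widehat{S}$, and (C2) each intersection of any oriented flat of $\mathbb{Y}$ with $\widehat{S}$ is discrete. A set $S\subseteq G$ is a set of representatives for $\widehat{S}$ if the quotient map $\pi^\Gamma\colon G\to\Gamma\backslash G$ restricts to a bijection from $S$ onto $\widehat{S}$. Next intersections and strong cross section. Let $\widehat{S}$ be a cross section and $\Gamma g\in\widehat{S}$. Put $T=\{t\in(\mathbb{R}_{>0})^r\mid\Gamma ga_t\in\widehat{S}\}$ and let $T_j$ be the projection of $T$ to the $j$-th coordinate. If $T\neq\emptyset$, one says that $\Gamma g$ has a next intersection with $\widehat{S}$ if $t_{0,j}=\min T_j$ exists for all $j$, $t_0=(t_{0,1},\ldots,t_{0,r})\in(\mathbb{R}_{>0})^r$, and $\Gamma ga_{t_0}\in\widehat{S}$; then $t_0$ is the first return time vector of $\Gamma g$. Let $\widehat{S}_1\subseteq\widehat{S}$ be the subset of elements having a next intersection; the first return map is $\widehat{R}\colon\widehat{S}_1\to\widehat{S}$, $\Gamma g\mapsto\Gamma ga_{t_0}$, with $t_0$ the first return time vector of $\Gamma g$. Consider the subset of $\widehat{S}$ of all elements that yield an infinite sequence of successive next intersections with $\widehat{S}$, i.e., all $\widehat{v}\in\widehat{S}$ for which $\widehat{R}^n(\widehat{v})$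 is defined for every $n\in\mathbb{N}$. If this subset is itself a cross section for the Weyl chamber flow on $\mathbb{Y}$, it is called the strong cross section contained in $\widehat{S}$. *)

(* Defs.v *)
From HB Require Import structures.
From mathcomp Require Import all_boot all_order all_algebra.
From mathcomp Require Import all_classical all_reals all_analysis.
From mathcomp.real_closed Require Import complex.
From mathcomp Require Import ring.

Set Implicit Arguments.
Unset Strict Implicit.
Unset Printing Implicit Defensive.

Import Order.TTheory GRing.Theory Num.Theory.
Import numFieldNormedType.Exports.

Local Open Scope classical_set_scope.
Local Open Scope ring_scope.
Local Open Scope complex_scope.
Local Open Scope quotient_scope.

(* [set_type] carries the subspace topology. *)
Definition SL2 (R : realType) : Type := set_type [set M : 'M[R]_2 | \det M = 1].
HB.instance Definition _ (R : realType) := Choice.on (SL2 R).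
HB.instance Definition _ (R : realType) := Topological.on (SL2 R).

Section SL2_group.
Variable R : realType.
Implicit Types M N : SL2 R.

Definition mkSL2 (A : 'M[R]_2) (h : \det A = 1) : SL2 R :=
  exist _ A (mem_set h).

Lemma det_SL2 M : \det (val M) = 1.
Proof. exact: (set_mem (valP M)). Qed.

Fact SL2_mul_subproof M N : \det (val M *m val N) = 1.
Proof. by rewrite det_mulmx !det_SL2 mulr1. Qed.

Fact SL2_inv_subproof M : \det (invmx (val M)) = 1.
Proof. by rewrite det_inv det_SL2 invr1. Qed.

Lemma SL2_unit M : val M \in unitmx.
Proof. by rewrite unitmxE det_SL2 unitr1. Qed.

Definition SL2_one : SL2 R := mkSL2 (det1 R 2).
Definition SL2_mul M N : SL2 R := mkSL2 (SL2_mul_subproof M N).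
Definition SL2_inv M : SL2 R := mkSL2 (SL2_inv_subproof M).

Fact SL2_mulA : associative SL2_mul.
Proof. by move=> M N P; apply/val_inj; rewrite /= mulmxA. Qed.

Fact SL2_mul1g : left_id SL2_one SL2_mul.
Proof. by move=> M; apply/val_inj; rewrite /= mul1mx. Qed.

Fact SL2_mulg1 : right_id SL2_one SL2_mul.
Proof. by move=> M; apply/val_inj; rewrite /= mulmx1. Qed.

Fact SL2_mulVg : left_inverse SL2_one SL2_inv SL2_mul.
Proof. by move=> M; apply/val_inj; rewrite /= mulVmx ?SL2_unit. Qed.

Fact SL2_mulgV : right_inverse SL2_one SL2_inv SL2_mul.
Proof. by move=> M; apply/val_inj; rewrite /= mulmxV ?SL2_unit. Qed.

HB.instance Definition _ := isGroup.Build (SL2 R)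
  SL2_mulA SL2_mul1g SL2_mulg1 SL2_mulVg SL2_mulgV.

Definition pm_eq M N : bool := (val M == val N) || (val M == - val N).

Lemma pm_eqP M N : reflect (exists b : bool, val M = (-1) ^+ b *: val N) (pm_eq M N).
Proof.
apply: (iffP orP) => [[/eqP->|/eqP->]|[[] ->]].
- by exists false; rewrite scale1r.
- by exists true; rewrite scaleN1r.
- by right; rewrite scaleN1r.
- by left; rewrite scale1r.
Qed.

Fact pm_eq_refl : reflexive pm_eq.
Proof. by move=> M; rewrite /pm_eq eqxx. Qed.

Fact pm_eq_sym : symmetric pm_eq.
Proof. by move=> M N; rewrite /pm_eq eq_sym -eqr_oppLR [- _ == _]eq_sym. Qed.

Fact pm_eq_trans : transitive pm_eq.
Proof.
move=> N M P /pm_eqP[b hb] /pm_eqP[c hc]; apply/pm_eqP; exists (b (+) c).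
by rewrite hb hc scalerA signr_addb.
Qed.

Canonical pm_equiv := EquivRel pm_eq pm_eq_refl pm_eq_sym pm_eq_trans.

End SL2_group.

Definition PSL2 (R : realType) : Type := quotient_topology {eq_quot (pm_equiv R)}.
HB.instance Definition _ (R : realType) := Choice.on (PSL2 R).
HB.instance Definition _ (R : realType) := Quotient.on (PSL2 R).
HB.instance Definition _ (R : realType) := Topological.on (PSL2 R).

Section PSL2_group.
Variable R : realType.
Implicit Types (g h : PSL2 R) (M N : SL2 R).

Definition psl (M : SL2 R) : PSL2 R := \pi_(PSL2 R) M.

Lemma psl_eqP M N : reflect (psl M = psl N) (pm_eq M N).
Proof. exact: (@eqquotP _ (pm_equiv R) {eq_quot (pm_equiv R)} M N). Qed.

Lemma repr_psl M : pm_eq (repr (psl M)) M.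
Proof. by apply/psl_eqP; rewrite /psl reprK. Qed.

Lemma pslK g : psl (repr g) = g.
Proof. exact: reprK. Qed.

Definition PSL2_one : PSL2 R := psl 1%g.
Definition PSL2_mul g h : PSL2 R := psl (repr g * repr h)%g.
Definition PSL2_inv g : PSL2 R := psl (repr g)^-1%g.

Lemma PSL2_mul_psl M N : PSL2_mul (psl M) (psl N) = psl (M * N)%g.
Proof.
have /pm_eqP[b hb] := repr_psl M; have /pm_eqP[c hc] := repr_psl N.
apply/psl_eqP/pm_eqP; exists (b (+) c).
by rewrite /= hb hc -scalemxAl -scalemxAr scalerA signr_addb.
Qed.

Lemma PSL2_inv_psl M : PSL2_inv (psl M) = psl M^-1%g.
Proof.
have /pm_eqP[b hb] := repr_psl M; apply/psl_eqP/pm_eqP; exists b.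
have u : (-1) ^+ b \is a @GRing.unit R by rewrite unitfE signr_eq0.
by rewrite /= hb invmxZ ?unitmxZ ?SL2_unit // invr_sign.
Qed.

Fact PSL2_mulA : associative PSL2_mul.
Proof.
move=> g h k; rewrite -[g]pslK -[h]pslK -[k]pslK.
by rewrite !PSL2_mul_psl mulgA.
Qed.

Fact PSL2_mul1g : left_id PSL2_one PSL2_mul.
Proof. by move=> g; rewrite -[g]pslK PSL2_mul_psl mul1g. Qed.

Fact PSL2_mulg1 : right_id PSL2_one PSL2_mul.
Proof. by move=> g; rewrite -[g]pslK PSL2_mul_psl mulg1. Qed.

Fact PSL2_mulVg : left_inverse PSL2_one PSL2_inv PSL2_mul.
Proof. by move=> g; rewrite -[g]pslK PSL2_inv_psl PSL2_mul_psl mulVg. Qed.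

Fact PSL2_mulgV : right_inverse PSL2_one PSL2_inv PSL2_mul.
Proof. by move=> g; rewrite -[g]pslK PSL2_inv_psl PSL2_mul_psl mulgV. Qed.

HB.instance Definition _ := isGroup.Build (PSL2 R)
  PSL2_mulA PSL2_mul1g PSL2_mulg1 PSL2_mulVg PSL2_mulgV.

End PSL2_group.

(* [R[i]^o] is R[i]; the tag selects its topology as a normed space over
   itself, which is the Euclidean topology of the plane. *)
Notation Cplx R := (complex R)^o (only parsing).
Definition sphere (R : realType) : Type := one_point_compactification (Cplx R).
HB.instance Definition _ (R : realType) := Choice.on (sphere R).
HB.instance Definition _ (R : realType) := Topological.on (sphere R).

Definition Hplane (R : realType) : Type := set_type [set z : Cplx R | 0 < complex.Im z].
HB.instance Definition _ (R : realType) := Choice.on (Hplane R).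
HB.instance Definition _ (R : realType) := Topological.on (Hplane R).

Section actions.
Variable R : realType.
Implicit Types (M N : SL2 R) (g : PSL2 R) (z : Cplx R).

Definition infty : sphere R := None.
Definition fin_pt (z : Cplx R) : sphere R := Some z.

Definition flt_num M z : Cplx R := ((val M) 0 0)%:C * z + ((val M) 0 1)%:C.
Definition flt_den M z : Cplx R := ((val M) 1 0)%:C * z + ((val M) 1 1)%:C.

Definition flt M (x : sphere R) : sphere R :=
  if x is Some z then
    if flt_den M z == 0 then infty else fin_pt (flt_num M z / flt_den M z)
  else
    if (val M) 1 0 == 0 then infty
    else fin_pt (((val M) 0 0)%:C / ((val M) 1 0)%:C).

(* Both actions of PSL_2(R) use a representative; they do not depend on its
   choice by [act_sphere_psl] and [act_H_sphere]. *)
Definition act_sphere g (x : sphere R) : sphere R := flt (repr g) x.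

Lemma flt_pm M N x : pm_eq M N -> flt M x = flt N x.
Proof.
move=> /pm_eqP[b hb].
have sC (u : R) : ((-1) ^+ b * u)%:C = (-1) ^+ b * u%:C.
  by rewrite rmorphM rmorphXn rmorphN1.
have sD (u v : Cplx R) : (-1) ^+ b * u / ((-1) ^+ b * v) = u / v.
  by rewrite -mulf_div divff ?signr_eq0 // mul1r.
have s0 (K : fieldType) (y : K) : ((-1) ^+ b * y == 0) = (y == 0).
  by rewrite mulf_eq0 signr_eq0.
case: x => [z|]; rewrite /flt /flt_num /flt_den hb !mxE.
  by rewrite !sC -!mulrA -!mulrDr sD s0.
by rewrite !sC sD s0.
Qed.

Lemma act_sphere_psl M : act_sphere (psl M) = flt M.
Proof. by apply/funext => x; apply/flt_pm/repr_psl. Qed.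

Lemma det_mx22 (A : 'M[R]_2) : \det A = A 0 0 * A 1 1 - A 0 1 * A 1 0.
Proof.
rewrite (expand_det_row _ 0) !big_ord_recl big_ord0 addr0.
rewrite /cofactor !det_mx11 !mxE /= expr0 mul1r expr1 mulN1r mulrN.
by congr (_ * A _ _ - A _ _ * A _ _); apply/val_inj.
Qed.

Lemma det_SL2_entries M :
  (val M) 0 0 * (val M) 1 1 - (val M) 0 1 * (val M) 1 0 = 1.
Proof. by rewrite -det_mx22 det_SL2. Qed.

Lemma flt_den_neq0 M z : 0 < complex.Im z -> flt_den M z != 0.
Proof.
move: (det_SL2_entries M); rewrite /flt_den; case: z => x y /=.
move: ((val M) 0 0) ((val M) 0 1) ((val M) 1 0) ((val M) 1 1) => a b c d.
move=> hdet y0; apply/eqP => /eqP; rewrite eq_complex /= => /andP[/eqP].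
rewrite !mul0r subr0 !addr0 => h1; rewrite mulf_eq0 (gt_eqF y0) orbF => /eqP c0.
move: h1 hdet; rewrite c0 mul0r add0r => ->.
by rewrite !mulr0 subrr => /eqP; rewrite eq_sym oner_eq0.
Qed.

Lemma Im_flt M z : 0 < complex.Im z -> 0 < complex.Im (flt_num M z / flt_den M z).
Proof.
move=> z0; have := flt_den_neq0 M z0.
move: (det_SL2_entries M) z0; rewrite /flt_num /flt_den; case: z => x y /=.
move: ((val M) 0 0) ((val M) 0 1) ((val M) 1 0) ((val M) 1 1) => a b c d.
move=> hdet y0; rewrite eq_complex /= !mul0r !subr0 !addr0 => hden.
have n0 : 0 < (c * x + d) ^+ 2 + (c * y) ^+ 2.
  by rewrite lt0r paddr_eq0 ?sqr_ge0 // !sqrf_eq0 hden addr_ge0 ?sqr_ge0.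
set n := _ + _ in n0 *.
suff -> : (a * x + b) * - (c * y / n) + a * y * ((c * x + d) / n) = y / n.
  exact: divr_gt0.
rewrite mulrN !mulrA addrC -mulrBl; congr (_ / n).
by rewrite -[RHS]mulr1 -hdet; ring.
Qed.

Lemma Hplane_gt0 (z : Hplane R) : 0 < complex.Im (val z).
Proof. exact: (set_mem (valP z)). Qed.

Definition mkH z (h : 0 < complex.Im z) : Hplane R := exist _ z (mem_set h).

Definition act_H g (z : Hplane R) : Hplane R :=
  mkH (Im_flt (repr g) (Hplane_gt0 z)).

Lemma act_H_sphere g (z : Hplane R) :
  fin_pt (val (act_H g z)) = act_sphere g (fin_pt (val z)).
Proof. by rewrite /act_sphere /= (negPf (flt_den_neq0 _ (Hplane_gt0 z))). Qed.

Definition base_i : Hplane R := @mkH (0 +i* 1) ltr01.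

End actions.

Section orbit_space.
Variables (gT : Type) (T : topologicalType) (act : gT -> T -> T).
Variable Gamma : set gT.

Definition orbit_set (x : T) : set T := [set act c x | c in Gamma].

Definition same_orbit (x y : T) : bool := `[< orbit_set x = orbit_set y >].

Fact same_orbit_refl : reflexive same_orbit.
Proof. by move=> x; apply/asboolP. Qed.

Fact same_orbit_sym : symmetric same_orbit.
Proof. by move=> x y; apply/asboolP/asboolP. Qed.

Fact same_orbit_trans : transitive same_orbit.
Proof. by move=> y x z /asboolP xy /asboolP yz; apply/asboolP; rewrite xy. Qed.

Canonical orbit_equiv :=
  EquivRel same_orbit same_orbit_refl same_orbit_sym same_orbit_trans.

Definition orbit_space : Type := quotient_topology {eq_quot orbit_equiv}.
HB.instance Definition _ := Choice.on orbit_space.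
HB.instance Definition _ := Quotient.on orbit_space.
HB.instance Definition _ := Topological.on orbit_space.

Definition orbit_pi (x : T) : orbit_space := \pi_orbit_space x.

Lemma orbit_piP (x y : T) :
  orbit_pi x = orbit_pi y <-> orbit_set x = orbit_set y.
Proof.
split=> [/(@eqquotP _ orbit_equiv {eq_quot orbit_equiv})/asboolP //|xy].
by apply/(@eqquotP _ orbit_equiv {eq_quot orbit_equiv})/asboolP.
Qed.

Lemma orbit_reprK (x : orbit_space) : orbit_pi (repr x) = x.
Proof. exact: reprK. Qed.

End orbit_space.

Definition prodG (R : realType) (r : nat) : Type := 'I_r -> PSL2 R.
HB.instance Definition _ (R : realType) (r : nat) :=
  Topological.copy (prodG R r) (prod_topology (fun _ : 'I_r => PSL2 R)).

Definition prodH (R : realType) (r : nat) : Type := 'I_r -> Hplane R.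
HB.instance Definition _ (R : realType) (r : nat) :=
  Topological.copy (prodH R r) (prod_topology (fun _ : 'I_r => Hplane R)).

Section prodG_group.
Variables (R : realType) (r : nat).
Implicit Types g h : prodG R r.

Definition prodG_one : prodG R r := fun=> 1%g.
Definition prodG_mul g h : prodG R r := fun j => (g j * h j)%g.
Definition prodG_inv g : prodG R r := fun j => (g j)^-1%g.

Fact prodG_mulA : associative prodG_mul.
Proof. by move=> g h k; apply/funext => j; rewrite /prodG_mul mulgA. Qed.

Fact prodG_mul1g : left_id prodG_one prodG_mul.
Proof. by move=> g; apply/funext => j; rewrite /prodG_mul mul1g. Qed.

Fact prodG_mulg1 : right_id prodG_one prodG_mul.
Proof. by move=> g; apply/funext => j; rewrite /prodG_mul mulg1. Qed.

Fact prodG_mulVg : left_inverse prodG_one prodG_inv prodG_mul.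
Proof. by move=> g; apply/funext => j; rewrite /prodG_mul mulVg. Qed.

Fact prodG_mulgV : right_inverse prodG_one prodG_inv prodG_mul.
Proof. by move=> g; apply/funext => j; rewrite /prodG_mul mulgV. Qed.

HB.instance Definition _ := isGroup.Build (prodG R r)
  prodG_mulA prodG_mul1g prodG_mulg1 prodG_mulVg prodG_mulgV.

Definition act_prodH (g : prodG R r) (z : prodH R r) : prodH R r :=
  fun j => act_H (g j) (z j).

Definition origin : prodH R r := fun=> base_i R.

Definition prod_set (Gamma : 'I_r -> set (PSL2 R)) : set (prodG R r) :=
  [set g | forall j, Gamma j (g j)].

End prodG_group.

Section diagonal.
Variable R : realType.

Fact diag_exp_subproof (t : R) :
  \det (diag_mx (\row_(j < 2) if j == 0 then expR (t / 2) else expR (- (t / 2)))) = 1.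
Proof. by rewrite det_diag !big_ord_recl big_ord0 !mxE /= mulr1 expRxMexpNx_1. Qed.

Definition psl_diag (t : R) : PSL2 R := psl (mkSL2 (diag_exp_subproof t)).

Variable r : nat.

Definition weyl_a (t : 'I_r -> R) : prodG R r := fun j => psl_diag (t j).
Definition weylA : set (prodG R r) := range weyl_a.
Definition weylA_reg : set (prodG R r) :=
  [set weyl_a t | t in [set t | forall j, t j != 0]].

End diagonal.

Section weyl_chamber_flow.
Variables (R : realType) (r : nat) (Gamma : set (prodG R r)).

Definition prodG_lmul (c g : prodG R r) : prodG R r := (c * g)%g.

Definition chambers : Type := orbit_space prodG_lmul Gamma.
HB.instance Definition _ := Choice.on chambers.
HB.instance Definition _ := Quotient.on chambers.
HB.instance Definition _ := Topological.on chambers.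

Definition chamber (g : prodG R r) : chambers := orbit_pi _ Gamma g.

Definition quotY : Type := orbit_space (@act_prodH R r) Gamma.
HB.instance Definition _ := Choice.on quotY.
HB.instance Definition _ := Quotient.on quotY.
HB.instance Definition _ := Topological.on quotY.

Definition flow (a : prodG R r) (x : chambers) : chambers :=
  chamber (repr x * a)%g.

Lemma flow_chamber a g : flow a (chamber g) = chamber (g * a)%g.
Proof.
apply/orbit_piP.
have /orbit_piP e : orbit_pi _ Gamma (repr (chamber g)) = chamber g.
  exact: orbit_reprK.
have mulr_orb (h : prodG R r) : orbit_set prodG_lmul Gamma (h * a)%g =
    [set (k * a)%g | k in orbit_set prodG_lmul Gamma h].
  rewrite /orbit_set image_comp; congr image.
  by apply/funext => c; rewrite /prodG_lmul /= mulgA.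
by rewrite !mulr_orb e.
Qed.

(* The class Gamma g A in Gamma \ G / A is represented by the orbit of Gamma g
   under the flow. *)
Definition flat_through (x : chambers) : set chambers :=
  [set flow a x | a in @weylA R r].

Definition oriented_flat (F : set chambers) : Prop :=
  exists x, F = flat_through x.

(* Gamma g A K is a subset of Gamma \ H^r via G / K = H^r, h K |-> h (i,...,i). *)
Definition underlying_flat (F : set chambers) : set quotY :=
  [set orbit_pi _ Gamma (act_prodH g (@origin R r)) | g in chamber @^-1` F].

Definition compact_flat (F : set chambers) : Prop :=
  oriented_flat F /\ compact (underlying_flat F).

Definition intersects_in (F S : set chambers) (x : chambers) : Prop :=
  S x /\ flat_through x = F.

Definition discrete_intersection (S : set chambers) (x : chambers) : Prop :=
  exists U : set (prodG R r), within (@weylA R r) (nbhs (1%g : prodG R r)) U /\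
    forall a, U a -> weylA_reg a -> ~ S (flow a x).

Definition cross_section (S : set chambers) : Prop :=
  (forall F, compact_flat F -> exists x, intersects_in F S x) /\
  (forall F x, oriented_flat F -> intersects_in F S x ->
     discrete_intersection S x).

Definition representatives (S : set (prodG R r)) (Sh : set chambers) : Prop :=
  set_bij S Sh chamber.

Definition return_times (S : set chambers) (x : chambers) : set ('I_r -> R) :=
  [set t | (forall j, 0 < t j) /\ S (flow (weyl_a t) x)].

Definition is_min (T : set R) (m : R) : Prop := T m /\ lbound T m.

Definition first_return_time (S : set chambers) (x : chambers)
    (t0 : 'I_r -> R) : Prop :=
  [/\ return_times S x !=set0,
      forall j, is_min [set t j | t in return_times S x] (t0 j),
      forall j, 0 < t0 j
    & S (flow (weyl_a t0) x)].

(* The graph of the first return map, a partial function. *)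
Definition first_return (S : set chambers) (x y : chambers) : Prop :=
  S x /\ exists2 t0, first_return_time S x t0 & y = flow (weyl_a t0) x.

Fixpoint iter_first_return (S : set chambers) (n : nat) (x y : chambers) : Prop :=
  if n is m.+1 then exists2 z, iter_first_return S m x z & first_return S z y
  else S x /\ y = x.

Definition infinite_returns (S : set chambers) : set chambers :=
  [set x | S x /\ forall n, exists y, iter_first_return S n x y].

Definition strong_cross_section_in (S Sst : set chambers) : Prop :=
  [/\ cross_section S, Sst = infinite_returns S & cross_section Sst].

End weyl_chamber_flow.

Section disks.
Variable R : realType.

Definition closed_disk (c rho : R) : set (Cplx R) :=
  [set z | `|z - c%:C| <= rho%:C].
Definition open_disk (c rho : R) : set (Cplx R) :=
  [set z | `|z - c%:C| < rho%:C].
Definition half_circle (c rho : R) : set (Hplane R) :=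
  [set z | `|val z - c%:C| = rho%:C].

Definition P1R : set (sphere R) :=
  [set x | if x is Some z then complex.Im z = 0 else True].

End disks.

(* The index set {+-1, ..., +-q} is encoded as 'I_q * bool, with (k, false)
   standing for k + 1 and (k, true) for - (k + 1). *)
Record schottky (R : realType) := Schottky {
  sch_q : nat;
  sch_q_gt0 : (0 < sch_q)%N;
  sch_center : 'I_sch_q * bool -> R;
  sch_radius : 'I_sch_q * bool -> R;
  sch_radius_gt0 : forall k, 0 < sch_radius k;
  sch_disjoint : forall k l, k != l ->
    closed_disk (sch_center k) (sch_radius k) `&`
    closed_disk (sch_center l) (sch_radius l) = set0;
  sch_gen : 'I_sch_q -> PSL2 R;
  sch_genP : forall k : 'I_sch_q,
    act_sphere (sch_gen k) @`
      (~` (@fin_pt R @`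
         closed_disk (sch_center (k, false)) (sch_radius (k, false)))) =
    @fin_pt R @` open_disk (sch_center (k, true)) (sch_radius (k, true))
}.

Section schottky_group.
Variables (R : realType) (D : schottky R).

Definition schottky_group : set (PSL2 R) :=
  smallest [set S : set (PSL2 R) | group_closed [in S]] (range (@sch_gen R D)).

Definition side (k : 'I_(sch_q D) * bool) : set (Hplane R) :=
  half_circle (sch_center k) (sch_radius k).

Definition forward_interval (k : 'I_(sch_q D) * bool) : set (sphere R) :=
  @P1R R `\` (@fin_pt R @` closed_disk (sch_center k) (sch_radius k)).

Definition sectionC : set (PSL2 R) :=
  [set g | exists k, side k (act_H g (base_i R)) /\
                     forward_interval k (act_sphere g (infty R))].

End schottky_group.

(* The limit points of Gamma z do not depend on z for discrete Gamma. *)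
Definition limit_set (R : realType) (Gamma : set (PSL2 R)) : set (sphere R) :=
  [set x | P1R x /\ forall z : Hplane R,
     limit_point [set fin_pt (val (act_H g z)) | g in Gamma] x].

Definition sectionCst (R : realType) (D : schottky R) : set (PSL2 R) :=
  [set g | sectionC D g /\
           limit_set (schottky_group D) (act_sphere g (infty R))].

Section products.
Variables (R : realType) (r : nat) (Gamma : 'I_r -> set (PSL2 R)).

Definition factor_quot (j : 'I_r) : Type :=
  orbit_space (fun c g : PSL2 R => (c * g)%g) (Gamma j).

Definition factor_pi (j : 'I_r) (g : PSL2 R) : factor_quot j :=
  orbit_pi _ (Gamma j) g.

(* Products under the identification of (prod_j Gamma_j) \ G with
   prod_j (Gamma_j \ PSL_2(R)). *)
Definition prod_quot_set (S : forall j, set (factor_quot j)) :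
    set (chambers (prod_set Gamma)) :=
  [set chamber (prod_set Gamma) g | g in
     [set g : prodG R r | forall j, S j (factor_pi j (g j))]].

End products.

(* Main.v *)
Require Import Defs.
From mathcomp Require Import all_boot all_order all_algebra.
From mathcomp Require Import all_classical all_reals all_analysis.
From mathcomp.real_closed Require Import complex.
From mathcomp Require Import ring lra.

(* A disk with centre c and radius rho is encoded by the binary quadratic form
   ((x - c y)^2 - rho^2 y^2) / rho of discriminant 1, negative exactly on the
   points of P^1(R) inside the disk. Side pairings negate these forms:
   q_k (M_k v) = - q_(-k) v. On the geodesic of g in SL_2(R), with columns
   v = g e_1 (forward) and u = g e_2 (backward), the quantity
   h_k = q_k v + q_k u has the sign of the position with respect to the side
   s_k, and along the flow it is e^t q_k v + e^-t q_k u, so that crossing times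
   are explicit.

   For k <> l, disjointness of the disks makes q_l + p q_k positive definite,
   where p > 1 is minus the polar form of q_k and q_l. This single inequality
   gives the ping-pong dynamics, hence the uniqueness of representatives and the
   discreteness of the intersections; it also shows that q_l (w e_1) grows
   geometrically along a reduced word w, so that the nested disks w^-1 D_l, of
   radius 1 / q_l (w e_1), shrink to points. Therefore the limit set consists of
   the points with an infinite itinerary, i.e. those whose successive images
   under the side pairings always lie in some open disk; these are the endpoints
   of the geodesic rays that cross sides forever. A ray whose endpoint has no
   infinite itinerary leaves every region |h_k| < H modulo the group, so that it
   does not project into a compact set. *)

Set Implicit Arguments.
Unset Strict Implicit.
Unset Printing Implicit Defensive.

Import Order.TTheory GRing.Theory Num.Theory.
Import numFieldNormedType.Exports.

Local Open Scope classical_set_scope.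
Local Open Scope ring_scope.
Local Open Scope complex_scope.
Local Open Scope quotient_scope.

(** * Disk forms *)

Section linear_action.
Variable R : realType.
Implicit Types (M N : SL2 R) (v u : R * R).

Definition mv M v : R * R :=
  (val M 0 0 * v.1 + val M 0 1 * v.2, val M 1 0 * v.1 + val M 1 1 * v.2).

Definition col1 M : R * R := mv M (1, 0).
Definition col2 M : R * R := mv M (0, 1).

Lemma mulmx22 (A B : 'M[R]_2) i j : (A *m B) i j = A i 0 * B 0 j + A i 1 * B 1 j.
Proof.
rewrite mxE !big_ord_recl big_ord0 addr0.
by congr (_ + A _ _ * B _ _); apply/val_inj.
Qed.

Lemma mvM M N v : mv (M * N)%g v = mv M (mv N v).
Proof. by rewrite /mv /= !mulmx22 /=; congr pair; ring. Qed.

Lemma mv1 v : mv 1%g v = v.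
Proof. by case: v => x y; rewrite /mv /= !mxE /=; congr pair; ring. Qed.

Lemma mvK M : cancel (mv M) (mv M^-1%g).
Proof. by move=> v; rewrite -mvM mulVg mv1. Qed.

Lemma mvZ M c v : mv M (c * v.1, c * v.2) = (c * (mv M v).1, c * (mv M v).2).
Proof. by rewrite /mv /=; congr pair; ring. Qed.

Lemma mv_det M v u :
  (mv M v).1 * (mv M u).2 - (mv M v).2 * (mv M u).1 = v.1 * u.2 - v.2 * u.1.
Proof.
rewrite /mv /=.
transitivity ((val M 0 0 * val M 1 1 - val M 0 1 * val M 1 0) *
              (v.1 * u.2 - v.2 * u.1)); first by ring.
by rewrite det_SL2_entries mul1r.
Qed.

Lemma mv0 M : mv M (0, 0) = (0, 0).
Proof. by rewrite /mv /= !mulr0 addr0. Qed.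

Lemma mv_neq0 M v : v != (0, 0) -> mv M v != (0, 0).
Proof. by apply: contra_neq => h; rewrite -[v](mvK M) h mv0. Qed.

Lemma col1M M N : col1 (M * N)%g = mv M (col1 N).
Proof. exact: mvM. Qed.

Lemma col2M M N : col2 (M * N)%g = mv M (col2 N).
Proof. exact: mvM. Qed.

Lemma col_det M : (col1 M).1 * (col2 M).2 - (col1 M).2 * (col2 M).1 = 1.
Proof. by rewrite mv_det /=; ring. Qed.

Lemma col1_neq0 M : col1 M != (0, 0).
Proof. by apply: mv_neq0; rewrite xpair_eqE oner_eq0. Qed.

End linear_action.

Section disk_forms.
Variable R : realType.
Implicit Types (c rho : R) (v u : R * R).

(* The binary quadratic form of discriminant 1 that is negative exactly on the
   lines of R^2 representing the points of ]c - rho, c + rho[. *)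
Definition disk_form c rho v : R :=
  ((v.1 - c * v.2) ^+ 2 - rho ^+ 2 * v.2 ^+ 2) / rho.

Lemma disk_formZ c rho a v : disk_form c rho (a * v.1, a * v.2) = a ^+ 2 * disk_form c rho v.
Proof. by rewrite /disk_form /=; ring. Qed.

(* The factor is minus the polar form of the two normalised disk forms, that
   is, cosh of the distance between the two geodesics bounding the disks. *)
Lemma disk_form_disjoint c1 r1 c2 r2 : 0 < r1 -> 0 < r2 -> r1 + r2 < `|c1 - c2| ->
  exists2 p, 1 < p & forall v, v != (0, 0) ->
    0 < disk_form c2 r2 v + p * disk_form c1 r1 v.
Proof.
move=> r1_gt0 r2_gt0 hd; set p := ((c1 - c2) ^+ 2 - r1 ^+ 2 - r2 ^+ 2) / (2 * r1 * r2).
have p1 : 1 < p.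
  rewrite ltr_pdivlMr ?mulr_gt0 //.
  have : (r1 + r2) ^+ 2 < `|c1 - c2| ^+ 2.
    by rewrite ltr_pXn2r // nnegrE ?normr_ge0 // addr_ge0 // ltW.
  by rewrite real_normK ?num_real // sqrrD; lra.
exists p => // -[x y] v0; rewrite /disk_form /=.
(* [A] is the coefficient of x^2 in the combined form and [B] half that of x y. Multiplying by [A]
   completes the square, and this value of [p] leaves exactly p^2 - 1 in front of y^2. *)
pose A := 1 / r2 + p / r1.
have A0 : 0 < A by rewrite addr_gt0 // divr_gt0 // (lt_trans _ p1).
pose B := - (c2 / r2 + p * c1 / r1).
rewrite -(pmulr_rgt0 _ A0).
have -> : A * (((x - c2 * y) ^+ 2 - r2 ^+ 2 * y ^+ 2) / r2 +
   p * (((x - c1 * y) ^+ 2 - r1 ^+ 2 * y ^+ 2) / r1)) =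
   (A * x + B * y) ^+ 2 + (p ^+ 2 - 1) * y ^+ 2.
  by rewrite /A /B /p; field; rewrite !gt_eqF.
have p2 : 0 < p ^+ 2 - 1 by rewrite subr_gt0 expr_gt1 // ltW // (lt_trans _ p1).
have [y0|y0] := eqVneq y 0; last first.
  by rewrite ltr_wpDl ?sqr_ge0 // mulr_gt0 // exprn_even_gt0.
have x0 : x != 0 by move: v0; rewrite y0 xpair_eqE eqxx andbT.
rewrite y0 !mulr0 addr0 expr0n /= mulr0 addr0 exprn_even_gt0 //=.
by rewrite mulf_neq0 // gt_eqF.
Qed.

End disk_forms.

Section complex_disks.
Variable R : realType.
Implicit Types (c rho x y : R).

Lemma ler_normc x y rho : 0 < rho ->
  (`|x +i* y : complex R| <= rho%:C) = (x ^+ 2 + y ^+ 2 <= rho ^+ 2).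
Proof.
move=> r0; rewrite normc_def lecR /= -[in LHS](@ler_pXn2r _ 2) // ?nnegrE ?sqrtr_ge0 ?(ltW r0) //.
by rewrite sqr_sqrtr // addr_ge0 ?sqr_ge0.
Qed.

Lemma ltr_normc x y rho : 0 < rho ->
  (`|x +i* y : complex R| < rho%:C) = (x ^+ 2 + y ^+ 2 < rho ^+ 2).
Proof.
move=> r0; rewrite normc_def ltcR /= -[in LHS](@ltr_pXn2r _ 2) // ?nnegrE ?sqrtr_ge0 ?(ltW r0) //.
by rewrite sqr_sqrtr // addr_ge0 ?sqr_ge0.
Qed.

Lemma eqr_normc x y rho : 0 < rho ->
  (`|x +i* y : complex R| == rho%:C) = (x ^+ 2 + y ^+ 2 == rho ^+ 2).
Proof.
move=> r0; rewrite normc_def (inj_eq (@complexI R)) /=.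
rewrite -(@eqrXn2 _ 2) // ?sqrtr_ge0 ?(ltW r0) //.
by rewrite sqr_sqrtr // addr_ge0 ?sqr_ge0.
Qed.

Lemma subc_real (x y c : R) : (x +i* y) - c%:C = (x - c) +i* y.
Proof. by apply/eqP; rewrite eq_complex /= subr0 !eqxx. Qed.

Lemma closed_diskE c rho (z : Cplx R) : 0 < rho ->
  closed_disk c rho z <-> (complex.Re z - c) ^+ 2 + complex.Im z ^+ 2 <= rho ^+ 2.
Proof. by case: z => x y r0; rewrite /closed_disk /= -ler_normc // subc_real. Qed.

Lemma open_diskE c rho (z : Cplx R) : 0 < rho ->
  open_disk c rho z <-> (complex.Re z - c) ^+ 2 + complex.Im z ^+ 2 < rho ^+ 2.
Proof. by case: z => x y r0; rewrite /open_disk /= -ltr_normc // subc_real. Qed.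

Lemma fin_pt_imageE (A : set (Cplx R)) z : (@fin_pt R @` A) (fin_pt z) <-> A z.
Proof. by split=> [[w Aw [<-]]|Az] //; exists z. Qed.

Lemma infty_imageE (A : set (Cplx R)) : ~ (@fin_pt R @` A) (infty R).
Proof. by case. Qed.

Lemma divc_real (x y : R) : x%:C / y%:C = (x / y)%:C.
Proof. by rewrite rmorphM /= fmorphV. Qed.

Lemma affc_real (a b x : R) : a%:C * x%:C + b%:C = (a * x + b)%:C :> complex R.
Proof. by rewrite rmorphD rmorphM. Qed.

Lemma flt_real (M : SL2 R) (x : R) :
  flt M (fin_pt x%:C) =
    let d := val M 1 0 * x + val M 1 1 in
    if d == 0 then infty R
    else fin_pt ((val M 0 0 * x + val M 0 1) / d)%:C.
Proof.
rewrite /= /flt_den /flt_num.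
rewrite -[(_ : Cplx R) + _]/((_ : complex R) + _) !affc_real.
rewrite (inj_eq (@complexI R) _ 0); case: ifP => // _.
by rewrite divc_real.
Qed.

Lemma flt_infty (M : SL2 R) :
  flt M (infty R) =
    if val M 1 0 == 0 then infty R else fin_pt (val M 0 0 / val M 1 0)%:C.
Proof. by rewrite /flt /infty divc_real. Qed.

(** Cross-multiplying the two images leaves det M times the difference of the points, or det M
    itself when [y] is infinity; the latter is excluded by det M = 1. *)
Lemma flt_inj_real (M : SL2 R) (x : R) (y : sphere R) :
  flt M (fin_pt x%:C) <> infty R ->
  flt M y = flt M (fin_pt x%:C) -> y = fin_pt x%:C.
Proof.
have detC : ((val M) 0 0)%:C * ((val M) 1 1)%:C - ((val M) 0 1)%:C * ((val M) 1 0)%:C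
    = 1 :> complex R.
  by rewrite -!rmorphM -rmorphB det_SL2_entries.
have det0 : ((val M) 0 0)%:C * ((val M) 1 1)%:C - ((val M) 0 1)%:C * ((val M) 1 0)%:C
    != 0 :> complex R by rewrite detC oner_neq0.
rewrite {1 3}/flt /flt_den /flt_num.
move: (x%:C : complex R) => w /=.
case: ifPn => // d0 _; case: y => [z|] /=; rewrite /flt_den /flt_num.
  case: ifPn => // d1 [] /eqP.
  rewrite eqr_div // => /eqP h; congr fin_pt; apply/eqP; rewrite -subr_eq0.
  rewrite -(mulrI_eq0 _ (mulfI det0)); apply/eqP.
  move: h; set a := (val M 0 0)%:C; set b := (val M 0 1)%:C.
  set c := (val M 1 0)%:C; set d := (val M 1 1)%:C => h.
  transitivity ((a * z + b) * (c * w + d) - (a * w + b) * (c * z + d)); first by ring.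
  by rewrite h subrr.
case: ifPn => // c0 [] /eqP.
have c0C : (val M 1 0)%:C != 0 by rewrite (inj_eq (@complexI R) _ 0).
rewrite eqr_div // => /eqP h.
case/eqP: det0; apply/eqP; rewrite subr_eq0; apply/eqP.
move: h; set a := (val M 0 0)%:C; set b := (val M 0 1)%:C.
set c := (val M 1 0)%:C; set d := (val M 1 1)%:C => h.
have : a * (c * w + d) - (a * w + b) * c = 0 by rewrite h subrr.
by move=> e; apply/eqP; rewrite -subr_eq0 -e; apply/eqP; ring.
Qed.

End complex_disks.

Section quadratic_roots.
Variable R : realType.

(** Continuity at [s] made explicit; the sign [e] chooses the side of [s]. For x <= 1 a positive
    value P drops by at most (L - 1) x, so it would still be positive at x = min 1 (P / L). *)
Lemma quadratic_root (A B C s e : R) : e ^+ 2 = 1 ->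
  0 <= A * s ^+ 2 + B * s + C ->
  (forall x, 0 < x -> A * (s + e * x) ^+ 2 + B * (s + e * x) + C < 0) ->
  A * s ^+ 2 + B * s + C = 0.
Proof.
move=> e2 P0 hP; apply/eqP; rewrite eq_le P0 andbT leNgt; apply/negP => Pgt.
set P := _ + C in P0 Pgt.
pose L := `|A| + `|2 * A * s * e + B * e| + 1.
have L1 : 1 <= L by rewrite /L lerDr addr_ge0.
pose x := Num.min 1 (P / L).
have L0 : 0 < L by rewrite (lt_le_trans ltr01).
have x0 : 0 < x by rewrite lt_min ltr01 divr_gt0.
have x1 : x <= 1 by rewrite ge_min lexx.
have xP : x * L <= P by rewrite -ler_pdivlMr // ge_min lexx orbT.
have := hP x x0.
have -> : A * (s + e * x) ^+ 2 + B * (s + e * x) + C =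
  P + A * x ^+ 2 + (2 * A * s * e + B * e) * x.
  rewrite /P; transitivity (A * s ^+ 2 + B * s + C + A * e ^+ 2 * x ^+ 2 +
   (2 * A * s * e + B * e) * x); first by ring.
  by rewrite e2 mulr1.
apply/negP; rewrite -leNgt.
have h1 : - (`|A| * x) <= A * x ^+ 2.
  rewrite (@le_trans _ _ (- (`|A| * x ^+ 2))) //.
    by rewrite lerN2 ler_wpM2l // expr2 ler_piMl // ltW.
  by rewrite -mulNr ler_wpM2r ?sqr_ge0 // lerNl -normrN ler_norm.
have h2 : - (`|2 * A * s * e + B * e| * x) <= (2 * A * s * e + B * e) * x.
  by rewrite -mulNr ler_wpM2r ?(ltW x0) // lerNl -normrN ler_norm.
move: xP h1 h2; rewrite /L.
set T := 2 * A * s * e + B * e; rewrite !mulrDr mulr1 ![x * _]mulrC; lra.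
Qed.

End quadratic_roots.

Section pairing.
Variable R : realType.

(** On the points (x, 1) the pulled-back form is, up to the factor r', the quadratic polynomial [P].
    It is negative outside [c - r, c + r] and nonnegative inside, so its roots are c - r and c + r.
    The discriminant, unchanged since det M = 1, and the negative leading coefficient then fix the
    scalar. *)
Lemma pairing_disk_form (M : SL2 R) (c r c' r' : R) : 0 < r -> 0 < r' ->
  flt M @` (~` (@fin_pt R @` closed_disk c r)) = @fin_pt R @` open_disk c' r' ->
  forall v, disk_form c' r' (mv M v) = - disk_form c r v.
Proof.
move=> r0 r0' img.
pose P x := (val M 0 0 * x + val M 0 1 - c' * (val M 1 0 * x + val M 1 1)) ^+ 2
  - r' ^+ 2 * (val M 1 0 * x + val M 1 1) ^+ 2.
have aux (n d : R) : d != 0 ->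
    open_disk c' r' (n / d)%:C <-> (n - c' * d) ^+ 2 - r' ^+ 2 * d ^+ 2 < 0.
  move=> d0; rewrite open_diskE //= expr0n addr0 subr_lt0.
  have d2 : 0 < d ^+ 2 by rewrite exprn_even_gt0.
  by rewrite -[_ < r' ^+ 2](ltr_pM2r d2) -exprMn mulrBl divfK.
have openP x : val M 1 0 * x + val M 1 1 != 0 ->
    open_disk c' r' ((val M 0 0 * x + val M 0 1) /
      (val M 1 0 * x + val M 1 1))%:C <-> P x < 0.
  exact: aux.
have neg x : r ^+ 2 < (x - c) ^+ 2 -> P x < 0.
  move=> hx; have : (@fin_pt R @` open_disk c' r') (flt M (fin_pt x%:C)).
    rewrite -img; exists (fin_pt x%:C) => //= /fin_pt_imageE.
    by rewrite closed_diskE //= expr0n addr0 leNgt hx.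
  rewrite flt_real /=; case: ifPn => [_ /infty_imageE //|d0].
  by move/fin_pt_imageE/openP; apply.
have pos x : (x - c) ^+ 2 <= r ^+ 2 -> 0 <= P x.
  move=> hx; rewrite leNgt; apply/negP => Px.
  have [d0|d0] := eqVneq (val M 1 0 * x + val M 1 1) 0.
    by move: Px; rewrite /P d0 !mulr0 expr0n mulr0 !subr0 ltNge sqr_ge0.
  have e : flt M (fin_pt x%:C) = fin_pt ((val M 0 0 * x + val M 0 1) /
      (val M 1 0 * x + val M 1 1))%:C by rewrite flt_real /= (negPf d0).
  have : (@fin_pt R @` open_disk c' r') (flt M (fin_pt x%:C)).
    by rewrite e; apply/fin_pt_imageE/openP.
  rewrite -img => -[y ny /flt_inj_real]; rewrite e => /(_ _)/wrap[] // yx.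
  by apply: ny; rewrite yx; apply/fin_pt_imageE/closed_diskE; rewrite //= expr0n addr0.
pose al := val M 0 0 - c' * val M 1 0; pose be := val M 0 1 - c' * val M 1 1.
pose A := al ^+ 2 - r' ^+ 2 * val M 1 0 ^+ 2.
pose B := 2 * (al * be - r' ^+ 2 * val M 1 0 * val M 1 1).
pose C := be ^+ 2 - r' ^+ 2 * val M 1 1 ^+ 2.
have PE x : P x = A * x ^+ 2 + B * x + C by rewrite /P /A /B /C /al /be; ring.
have root e : e ^+ 2 = 1 -> P (c + e * r) = 0.
  move=> e2; rewrite PE; apply: (quadratic_root e2).
    by rewrite -PE; apply: pos; rewrite [c + _]addrC addrK exprMn e2 mul1r.
  move=> x x0; rewrite -PE; apply: neg.
  have -> : c + e * r + e * x - c = e * (r + x) by ring.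
  rewrite exprMn e2 mul1r ltr_pXn2r // ?nnegrE ?ltrDl // ltW // addr_gt0 //.
have := root 1 (expr1n _ _); have := root (-1); rewrite sqrrN expr1n => /(_ erefl).
rewrite !PE => h1 h2.
have Bc : B = - 2 * A * c.
  have r4 : 2 * r != 0 by rewrite mulf_neq0 ?gt_eqF.
  by apply: (mulfI r4); lra.
have Cc : C = A * (c ^+ 2 - r ^+ 2) by rewrite Bc in h1; lra.
have A0 : A < 0.
  have : P (c + 2 * r) < 0.
    apply: neg; rewrite [c + _]addrC addrK exprMn ltr_pMl ?exprn_gt0 //; lra.
  rewrite PE Bc Cc.
  have -> : A * (c + 2 * r) ^+ 2 + -2 * A * c * (c + 2 * r) + A * (c ^+ 2 - r ^+ 2)
    = A * (3 * r ^+ 2) by ring.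
  by rewrite pmulr_llt0 // mulr_gt0 // exprn_gt0.
have disc : (A * r) ^+ 2 = r' ^+ 2.
  have : B ^+ 2 - 4 * A * C = 4 * r' ^+ 2.
    transitivity (4 * r' ^+ 2 *
      (val M 0 0 * val M 1 1 - val M 0 1 * val M 1 0) ^+ 2).
      by rewrite /A /B /C /al /be; ring.
    by rewrite det_SL2_entries expr1n mulr1.
  rewrite Bc Cc; lra.
have Ar : A = - (r' / r).
  have : - (A * r) = r'.
    apply/eqP; rewrite -(@eqrXn2 _ 2) ?sqrrN ?disc //; last exact: ltW.
    by rewrite -mulNr mulr_ge0 ?oppr_ge0 // ltW.
  by move=> <-; field; rewrite gt_eqF.
case=> x y; rewrite /disk_form /mv /=.
transitivity ((A * x ^+ 2 + B * x * y + C * y ^+ 2) / r').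
  by congr (_ / r'); rewrite /A /B /C /al /be; ring.
by rewrite Bc Cc Ar; field; rewrite !gt_eqF.
Qed.

End pairing.

Section schottky_forms.
Variables (R : realType) (D : schottky R).
Local Notation letter := ('I_(sch_q D) * bool)%type.
Implicit Types (k l : letter) (v u : R * R) (M N : SL2 R).

Definition opp k : letter := (k.1, ~~ k.2).

Lemma oppK : involutive opp.
Proof. by case=> i b; rewrite /opp negbK. Qed.

Lemma opp_neq k : opp k != k.
Proof. by case: k => i [] /=; rewrite xpair_eqE andbF. Qed.

Definition side_form k v := disk_form (sch_center k) (sch_radius k) v.

(** This is 2 sinh of the signed distance from g(i) to the side [k], positive outside the disk. *)
Definition side_height k M := side_form k (col1 M) + side_form k (col2 M).

(** Indexed by its target: a lift of the side pairing that carries the exterior of the disk [opp k]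
    into the disk [k]. *)
Definition side_map k : SL2 R :=
  if k.2 then repr (sch_gen k.1) else (repr (sch_gen k.1))^-1%g.

Lemma side_map_opp k : side_map (opp k) = (side_map k)^-1%g.
Proof. by case: k => i []; rewrite /side_map //= invgK. Qed.

Lemma side_mapK k : cancel (mv (side_map k)) (mv (side_map (opp k))).
Proof. by move=> v; rewrite side_map_opp mvK. Qed.

Lemma side_mapVK k : cancel (mv (side_map (opp k))) (mv (side_map k)).
Proof. by move=> v; rewrite -{1}[k]oppK side_mapK. Qed.

Lemma side_form_side_map k v : side_form k (mv (side_map k) v) = - side_form (opp k) v.
Proof.
case: k => i b.
have h u : side_form (i, true) (mv (side_map (i, true)) u) = - side_form (i, false) u.
  apply: pairing_disk_form; rewrite ?sch_radius_gt0 //; exact: (sch_genP i).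
case: b => //=; rewrite -[v in RHS](@side_mapVK (i, true)) h opprK.
by rewrite /opp /=.
Qed.

Lemma side_height_side_map k M : side_height k (side_map k * M)%g = - side_height (opp k) M.
Proof. by rewrite /side_height col1M col2M !side_form_side_map opprD. Qed.

Lemma side_formZ k a v : side_form k (a * v.1, a * v.2) = a ^+ 2 * side_form k v.
Proof. exact: disk_formZ. Qed.

Lemma radius_sum_lt k l : k != l ->
  sch_radius k + sch_radius l < `|sch_center k - sch_center l|.
Proof.
move=> kl; rewrite ltNge; apply/negP => hd.
have r1 := sch_radius_gt0 k; have r2 := sch_radius_gt0 l.
have s0 : 0 < sch_radius k + sch_radius l by rewrite addr_gt0.
pose s := sch_radius k + sch_radius l; pose d := sch_center k - sch_center l.
have hd2 : d ^+ 2 <= s ^+ 2.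
  by rewrite -(real_normK (num_real d)) ler_pXn2r // nnegrE ?normr_ge0 ?ltW.
have bnd t : 0 <= t -> (t * d / s) ^+ 2 <= t ^+ 2.
  move=> t0; rewrite expr_div_n ler_pdivrMr ?exprn_gt0 // exprMn.
  by rewrite ler_wpM2l // sqr_ge0.
(* The point dividing the segment between the centres in the ratio of the radii; it would lie in
   both disks. *)
pose x := sch_center k - sch_radius k * d / s.
suff : (closed_disk (sch_center k) (sch_radius k) `&`
        closed_disk (sch_center l) (sch_radius l)) x%:C by rewrite sch_disjoint.
split; apply/closed_diskE; rewrite //= expr0n addr0.
  have -> : x - sch_center k = - (sch_radius k * d / s) by rewrite /x; ring.
  by rewrite sqrrN bnd // ltW.
have -> : x - sch_center l = sch_radius l * d / s.
  by rewrite /x /d /s; field; rewrite gt_eqF.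
by rewrite bnd // ltW.
Qed.

End schottky_forms.

(** * Ping-pong *)

Section finite_bounds.
Variables (R : realType) (T : finType) (f : T -> R).

Lemma finite_lower_bound a : (forall i, a < f i) -> exists2 m, a < m & forall i, m <= f i.
Proof.
move=> af; exists (\big[Num.min/a + 1]_i f i); last by move=> i; apply: bigmin_le.
by apply: lt_bigmin => //; rewrite ltrDl.
Qed.

Lemma finite_upper_bound a : exists2 m, a < m & forall i, f i < m.
Proof.
exists (\big[Num.max/a]_i f i + 1) => [|i]; rewrite ltr_pwDr //.
  exact: bigmax_ge_id.
exact: le_bigmax.
Qed.

End finite_bounds.

Section dynamics.
Variables (R : realType) (D : schottky R).
Local Notation letter := ('I_(sch_q D) * bool)%type.
Local Notation opp := (@opp R D).
Implicit Types (k l m : letter) (v u : R * R) (M N : SL2 R) (w : seq letter).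

(** There are finitely many pairs of disks, so their constants have a common lower bound above 1.
    This [lam] is the expansion rate along itineraries. *)
Lemma form_gap : exists2 lam : R, 1 < lam & forall k l, k != l ->
  exists2 p, lam <= p & forall v, v != (0, 0) -> 0 < side_form l v + p * side_form k v.
Proof.
have /choice[p hp] : forall kl : letter * letter, exists x : R, 1 < x /\
    (kl.1 != kl.2 -> forall v, v != (0, 0) -> 0 < side_form kl.2 v + x * side_form kl.1 v).
  move=> [k l] /=.
  have [_|kl] := eqVneq k l; first by exists 2; split=> //; lra.
  have [p p1 hp] := disk_form_disjoint (sch_radius_gt0 k) (sch_radius_gt0 l)
    (radius_sum_lt kl).
  by exists p.
have [lam lam1 hlam] := finite_lower_bound (fun kl => (hp kl).1).
exists lam => // k l kl; exists (p (k, l)) => //.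
exact: (hp (k, l)).2.
Qed.

Lemma side_form_gt0 k l v : k != l -> v != (0, 0) -> side_form k v <= 0 -> 0 < side_form l v.
Proof.
move=> kl v0 qv; have [lam lam1 /(_ _ _ kl)[p lp /(_ _ v0)]] := form_gap.
nra.
Qed.

Lemma side_height_gap_gt0 k l p M :
  (forall v, v != (0, 0) -> 0 < side_form l v + p * side_form k v) ->
  0 < side_height l M + p * side_height k M.
Proof.
move=> hp; have c2 : col2 M != (0, 0).
  by apply: mv_neq0; rewrite xpair_eqE oner_eq0 andbF.
rewrite /side_height; have := hp _ (col1_neq0 M); have := hp _ c2; lra.
Qed.

Lemma side_height_gt0 k l M : k != l -> side_height k M <= 0 -> 0 < side_height l M.
Proof.
move=> kl qv; have [lam lam1 /(_ _ _ kl)[p lp /(side_height_gap_gt0 M)]] := form_gap.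
nra.
Qed.

Lemma side_height_ge k l M H : k != l -> 0 <= H -> side_height k M <= - H -> H <= side_height l M.
Proof.
move=> kl qv; have [lam lam1 /(_ _ _ kl)[p lp /(side_height_gap_gt0 M)]] := form_gap.
nra.
Qed.

Definition word w : SL2 R := foldr (fun k M => (side_map k * M)%g) 1%g w.

Lemma word_cat w1 w2 : word (w1 ++ w2) = (word w1 * word w2)%g.
Proof. by elim: w1 => [|k w1 IH] /=; rewrite ?mul1g // IH mulgA. Qed.

Definition reduced w := sorted (fun k l => l != opp k) w.

Lemma word_reduced_cons k w : reduced w ->
  exists2 w', reduced w' & word (k :: w) = word w'.
Proof.
case: w => [|l w] rw; first by exists [:: k].
have [e|ne] := eqVneq l (opp k); last by exists [:: k, l & w] => //=; rewrite ne.
exists w; first by move: rw; rewrite /reduced /=; exact: path_sorted.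
by rewrite /= e side_map_opp mulVKg.
Qed.

Lemma word_reduced w : exists2 w', reduced w' & word w = word w'.
Proof.
elim: w => [|k w [w' rw' e]]; first by exists [::].
have [w2 rw2 e2] := word_reduced_cons k rw'.
by exists w2 => //; rewrite -e2 /= e.
Qed.

Lemma word_inv w : (word w)^-1%g = word (rev (map opp w)).
Proof.
elim: w => [|k w IH] /=; first by rewrite invg1.
by rewrite invgM IH rev_cons -cats1 word_cat /= mulg1 side_map_opp.
Qed.

Lemma pslM M N : psl (M * N)%g = (psl M * psl N)%g.
Proof. by rewrite -PSL2_mul_psl. Qed.

Lemma pslV M : psl (M^-1)%g = (psl M)^-1%g.
Proof. by rewrite -PSL2_inv_psl. Qed.

Lemma schottky_group_closed : group_closed [in schottky_group D].
Proof.
split=> [|g h]; rewrite !inE.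
  by move=> S [[S1 _] _]; rewrite inE in S1.
move=> Gg Gh S [/= [S1 SV] GS].
have := SV g h; rewrite !inE; apply.
  by apply: Gg.
by apply: Gh.
Qed.

Lemma schottky_group1 : schottky_group D 1%g.
Proof. by have [] := schottky_group_closed; rewrite inE. Qed.

Lemma schottky_groupM g h :
  schottky_group D g -> schottky_group D h -> schottky_group D (g * h)%g.
Proof.
move=> Gg Gh; have := group_closedM schottky_group_closed.
by move=> /(_ g h); rewrite !inE; apply.
Qed.

Lemma schottky_groupV g : schottky_group D g -> schottky_group D g^-1%g.
Proof.
move=> Gg; have := group_closedV schottky_group_closed.
by move=> /(_ g); rewrite !inE; apply.
Qed.

Lemma schottky_group_word w : schottky_group D (psl (word w)).
Proof.
elim: w => [|[i b] w IH] /=; first exact: schottky_group1.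
rewrite pslM; apply: schottky_groupM => //.
have gi : schottky_group D (sch_gen i) by apply: sub_gen_smallest; exists i.
by case: b; rewrite /side_map /= ?pslV pslK //; exact: schottky_groupV.
Qed.

Lemma schottky_groupP g : schottky_group D g ->
  exists2 w, reduced w & g = psl (word w).
Proof.
move=> Gg; suff [w ->] : exists w, g = psl (word w).
  by have [w' rw' ->] := word_reduced w; exists w'.
move: g Gg; apply: smallest_sub => [|_ [i _ <-]]; last first.
  by exists [:: (i, true)]; rewrite /= mulg1 /side_map pslK.
split=> [|g h]; rewrite !inE; first by exists [::].
move=> [w1 ->] [w2 ->]; exists (w1 ++ rev (map opp w2)).
by rewrite word_cat -word_inv -pslV -pslM.
Qed.

(* Ping-pong, keeping track of the depth inside the disks. *)
Lemma word_depth w k M H : 0 <= H -> reduced (k :: w) ->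
  H <= side_height (opp (last k w)) M -> side_height k (word (k :: w) * M)%g <= - H.
Proof.
move=> H0; elim: w k => [|l w IH] k /=.
  by move=> _ hM; rewrite mulg1 side_height_side_map lerN2.
move=> /andP[lk rw] hM; rewrite -mulgA side_height_side_map lerN2.
by apply: (@side_height_ge l) => //; exact: IH.
Qed.

(** The points with all heights positive form the open fundamental domain; [word_depth] sends them
    into the disk of the first letter. *)
Lemma word_fundamental w M : (forall l, 0 < side_height l M) -> reduced w -> w != [::] ->
  exists k, side_height k (word w * M)%g < 0.
Proof.
case: w => // k w hM rw _; exists k.
have := @word_depth w k M (side_height (opp (last k w)) M) (ltW (hM _)) rw (lexx _).
by move/le_lt_trans; apply; rewrite oppr_lt0.
Qed.

(** Translates of the open fundamental domain never meet a side; this is the source of discreteness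
    and of the minimality of return times. *)
Lemma word_fundamental_neq0 w M k : (forall l, 0 < side_height l M) ->
  side_height k (word w * M)%g != 0.
Proof.
have [w' rw' ->] := word_reduced w => hM.
have [->|w0] := eqVneq w' [::]; first by rewrite mul1g gt_eqF.
have [l hl] := word_fundamental hM rw' w0.
have [<-|lk] := eqVneq l k; first by rewrite lt_eqF.
by rewrite gt_eqF // (side_height_gt0 lk) // ltW.
Qed.

(** The point may be close to the single side [m], provided that it is far from all others and that
    the same holds for its image across [m]. [word_depth] needs a large height above [opp] of the
    last letter, which is missing only when the last letter is [opp m]. That letter is then absorbed
    into the point, and reducedness ensures that the new last letter is not [m]. *)
Lemma word_escape m M H w : 0 <= H -> (forall l, l != m -> H <= side_height l M) ->
  (forall l, l != opp m -> H <= side_height l (side_map (opp m) * M)%g) ->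
  exists k, H <= `|side_height k (word w * M)%g|.
Proof.
move=> H0 hm hom; have [{}w rw ->] := word_reduced w.
have deep w' k N : reduced (k :: w') -> H <= side_height (opp (last k w')) N ->
    H <= `|side_height k (word (k :: w') * N)%g|.
  by move=> r /(word_depth H0 r) h; rewrite lerNr in h; rewrite (le_trans h) // -normrN ler_norm.
have omm := opp_neq m.
case: w rw => [|k w] rw.
  exists (opp m); rewrite mul1g (le_trans (hm _ omm)) // ler_norm //.
have [e|ne] := eqVneq (opp (last k w)) m; last by exists k; apply: deep => //; exact: hm.
have {}e : last k w = opp m by rewrite -e oppK.
case/lastP: w e rw => [/= -> _|w a].
  exists m; rewrite mulg1 (le_trans (hom m _)) ?ler_norm // eq_sym //.
rewrite last_rcons => -> rw0.
have /andP[rw ne] : path (fun k l => l != opp k) k w && (opp m != opp (last k w)).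
  by move: rw0; rewrite /reduced /= rcons_path.
exists k; rewrite -rcons_cons -cats1 word_cat -mulgA [word [:: _]]/= mulg1.
apply: deep => //; apply: hom; rewrite eq_sym //.
Qed.

End dynamics.

(** * Itineraries *)

Lemma expr_unbounded (R : realType) (lam B : R) : 1 < lam -> exists n, B < lam ^+ n.
Proof.
move=> lam1; have [B0|B0] := ltP B 0; first by exists 0%N; rewrite expr0 (lt_trans B0).
have bern n : 1 + n%:R * (lam - 1) <= lam ^+ n.
  elim: n => [|n IH]; first by rewrite mul0r addr0 expr0.
  rewrite exprS (@le_trans _ _ (lam * (1 + n%:R * (lam - 1)))) //.
    rewrite -natr1; have : 0 <= n%:R * (lam - 1) ^+ 2 by rewrite mulr_ge0 ?sqr_ge0.
    lra.
  by rewrite ler_wpM2l // ltW // (lt_trans _ lam1).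
exists (Num.bound (B / (lam - 1))); apply: lt_le_trans (bern _).
have : B / (lam - 1) < (Num.bound (B / (lam - 1)))%:R.
  by apply: archi_boundP; apply: divr_ge0 => //; rewrite subr_ge0 ltW.
by rewrite ltr_pdivrMr ?subr_gt0 //; lra.
Qed.

Section itineraries.
Variables (R : realType) (D : schottky R).
Local Notation letter := ('I_(sch_q D) * bool)%type.
Local Notation opp := (@opp R D).
Implicit Types (k l m : letter) (v u : R * R) (M N : SL2 R) (w : seq letter).

Fixpoint itin n v : Prop :=
  if n is n'.+1 then exists2 l, side_form l v < 0 & itin n' (mv (side_map (opp l)) v)
  else True.

Definition infinite_itin v := forall n, itin n v.

Lemma itinZ n a v : a != 0 -> itin n v -> itin n (a * v.1, a * v.2).
Proof.
move=> a0; elim: n v => //= n IH v [l lv iv]; exists l.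
  by rewrite side_formZ pmulr_rlt0 // exprn_even_gt0.
by rewrite mvZ; apply: IH.
Qed.

Lemma itin_next n l v : v != (0, 0) -> side_form l v < 0 -> itin n.+1 v ->
  itin n (mv (side_map (opp l)) v).
Proof.
move=> v0 lv /= [k kv]; have [->//|kl] := eqVneq k l.
by have := side_form_gt0 kl v0 (ltW kv); rewrite ltNge ltW.
Qed.

Lemma infinite_itin_next l v : v != (0, 0) -> side_form l v < 0 -> infinite_itin v ->
  infinite_itin (mv (side_map (opp l)) v).
Proof. by move=> v0 lv iv n; apply: itin_next (iv n.+1). Qed.

Lemma infinite_itin_letter v : infinite_itin v -> exists l, side_form l v < 0.
Proof. by move=> /(_ 1)[l lv _]; exists l. Qed.

Lemma not_infinite_itin v : ~ infinite_itin v ->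
  exists w, forall l, 0 <= side_form l (mv (word w) v).
Proof.
move=> /existsNP[n]; elim: n v => [|n IH] v nv /=; first by case: nv.
have [[l lv]|nl] := pselect (exists l, side_form l v < 0); last first.
  exists [::] => l; rewrite mv1 leNgt; apply/negP => lv; apply: nl; by exists l.
have [|w hw] := IH (mv (side_map (opp l)) v).
  by move=> iv; apply: nv => /=; exists l.
by exists (w ++ [:: opp l]) => k; rewrite word_cat mvM /= mulg1.
Qed.

(** If [v] is in the disk [l] and [e] is outside it with form at least d, the map of [opp l] throws
    [e] into the disk [opp l] to depth d. Every other disk, in particular the next one containing
    [v], then sees [e] with form at least lam d: each letter gains a factor [lam]. *)
Lemma infinite_itin_pow lam : 1 < lam ->
    (forall k l v, k != l -> v != (0, 0) -> side_form k v <= 0 ->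
       - (lam * side_form k v) <= side_form l v) ->
  forall n v e d, v != (0, 0) -> e != (0, 0) -> infinite_itin v -> 0 < d ->
  (forall l, side_form l v < 0 -> d <= side_form l e) ->
  exists w l, [/\ infinite_itin (mv (word w) v), side_form l (mv (word w) v) < 0
                & lam ^+ n * d <= side_form l (mv (word w) e)].
Proof.
move=> lam1 hlam; elim=> [|n IH] v e d v0 e0 iv d0 hd.
  have [l lv] := infinite_itin_letter iv; exists [::], l.
  by rewrite !mv1 expr0 mul1r hd.
have [l lv] := infinite_itin_letter iv.
have qe := side_form_side_map (opp l); rewrite oppK in qe.
have ie := infinite_itin_next v0 lv iv.
have [||||k kv|w [m []]] := IH (mv (side_map (opp l)) v) (mv (side_map (opp l)) e) (lam * d).
- exact: mv_neq0.
- exact: mv_neq0.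
- by [].
- by rewrite mulr_gt0 // (lt_trans _ lam1).
- have lk : opp l != k.
    by apply: contraTneq kv => <-; rewrite qe -leNgt oppr_ge0 ltW.
  apply: le_trans (hlam _ _ _ lk (mv_neq0 _ e0) _); rewrite qe.
    by rewrite mulrN opprK ler_wpM2l // ?hd // ltW // (lt_trans _ lam1).
  by rewrite oppr_le0 (le_trans _ (hd l lv)) // ltW.
exists (w ++ [:: opp l]), m; rewrite word_cat /= mulg1 !mvM; split=> //.
by rewrite exprSr -mulrA.
Qed.

(** The vector (1, 0) represents infinity, where every side form equals 1 / radius > 0, so that a
    common starting value [d] exists. *)
Lemma infinite_itin_growth v B : v != (0, 0) -> infinite_itin v ->
  exists w l, [/\ infinite_itin (mv (word w) v), side_form l (mv (word w) v) < 0
                & B < side_form l (mv (word w) (1, 0))].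
Proof.
move=> v0 iv; have [lam lam1 hlam] := form_gap D.
have e0 : (1, 0) != (0, 0) :> R * R by rewrite xpair_eqE oner_eq0.
have qe l : 0 < side_form l (1, 0).
  have r0 := sch_radius_gt0 l; rewrite /side_form /disk_form /=.
  by rewrite mulr0 subr0 expr1n expr0n /= mulr0 subr0 divr_gt0.
have [d d0 hd] := finite_lower_bound qe.
have [n hn] : exists n, B < lam ^+ n * d.
  have [n hn] := expr_unbounded (B / d) lam1.
  by exists n; rewrite -ltr_pdivrMr.
have [k l u kl u0 qu||w [l [? ? ?]]] := @infinite_itin_pow lam lam1 _ n v (1, 0) d v0 e0 iv d0.
  have [p lp /(_ u u0)] := hlam k l kl; nra.
  by move=> l _; exact: hd.
by exists w, l; split => //; apply: lt_le_trans hn _.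
Qed.

(* Completing the square; the discriminant of the form is 1. *)
Lemma side_form_mv_square l N : exists b, forall v,
  side_form l (mv N (1, 0)) * side_form l (mv N v) =
    (side_form l (mv N (1, 0)) * v.1 + b * v.2) ^+ 2 - v.2 ^+ 2.
Proof.
have r0 := sch_radius_gt0 l; have dt := det_SL2_entries N.
set c := sch_center l; set r := sch_radius l in r0 *.
exists (((val N 0 0 - c * val N 1 0) * (val N 0 1 - c * val N 1 1) -
  r ^+ 2 * val N 1 0 * val N 1 1) / r) => -[x y]; rewrite /side_form /disk_form /mv /= -/c -/r.
rewrite [X in _ = _ - X](_ : _ =
  (val N 0 0 * val N 1 1 - val N 0 1 * val N 1 0) ^+ 2 * y ^+ 2); last first.
  by rewrite dt expr1n mul1r.
by field; rewrite gt_eqF.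
Qed.

(** A nested disk around [v] that is small enough excludes the distinct point [u]. If both were
    inside, [side_form_mv_square] and the determinant condition would give A <= 2 |v.2| |u.2|,
    whence the bound requested from [infinite_itin_growth]. *)
Lemma infinite_itin_separate v u : v.1 * u.2 - v.2 * u.1 = 1 -> infinite_itin v ->
  exists w l, [/\ infinite_itin (mv (word w) v), side_form l (mv (word w) v) < 0
                & 0 < side_form l (mv (word w) u)].
Proof.
move=> vu iv.
have v0 : v != (0, 0).
  by apply: contra_eqN vu => /eqP ->; rewrite !mul0r subrr eq_sym oner_eq0.
have [w [l [iw lw hA]]] := infinite_itin_growth (2 * `|v.2| * `|u.2|) v0 iv.
exists w, l; split => //; rewrite ltNge; apply/negP => lu.
set A := side_form l (mv (word w) (1, 0)) in hA.
have [b hb] := side_form_mv_square l (word w).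
have A0 : 0 < A by apply: le_lt_trans hA; rewrite !mulr_ge0.
have sq s t : s ^+ 2 - t ^+ 2 <= 0 -> `|s| <= `|t| :> R.
  by rewrite subr_le0 -(real_normK (num_real s)) -(real_normK (num_real t)) ler_pXn2r ?nnegrE.
have hv : `|A * v.1 + b * v.2| <= `|v.2|.
  by apply: sq; rewrite -hb pmulr_rle0 // ltW.
have hu : `|A * u.1 + b * u.2| <= `|u.2| by apply: sq; rewrite -hb pmulr_rle0.
have : A <= 2 * `|v.2| * `|u.2|; last by rewrite leNgt hA.
have -> : A = (A * v.1 + b * v.2) * u.2 - (A * u.1 + b * u.2) * v.2.
  by transitivity (A * (v.1 * u.2 - v.2 * u.1)); [rewrite vu mulr1 | ring].
rewrite (le_trans (ler_norm _)) // (le_trans (ler_normB _ _)) // !normrM.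
have := ler_wpM2r (normr_ge0 u.2) hv; have := ler_wpM2r (normr_ge0 v.2) hu; lra.
Qed.

(** The hypotheses of [word_escape] are packed into finitely many height conditions that are open at
    [v]. They hold both far along a ray ending at [v] and for orbit points close to [v], which
    serves compact flats and limit points alike. *)
Lemma not_infinite_itin_escape v : v != (0, 0) -> ~ infinite_itin v ->
  exists (N : letter * bool -> SL2 R) (f : letter * bool -> letter),
    (forall i, 0 < side_form (f i) (mv (N i) v)) /\
    forall M H, 0 <= H -> (forall i, H <= side_height (f i) (N i * M)%g) ->
      forall w, exists k, H <= `|side_height k (word w * M)%g|.
Proof.
move=> v0 /not_infinite_itin[w0 hw0].
(* The moved point lies in no open disk and on the boundary of at most one, which becomes [m];
   without such a disk any letter serves. *)
have [m hm] : exists m, forall l, l != m -> 0 < side_form l (mv (word w0) v).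
  have [[m m0]|n0] := pselect (exists m, side_form m (mv (word w0) v) = 0).
    by exists m => l lm; rewrite (@side_form_gt0 _ _ m) ?m0 ?mv_neq0 // eq_sym.
  exists (Ordinal (sch_q_gt0 D), true) => l _; rewrite lt_neqAle hw0 andbT eq_sym.
  by apply/eqP => l0; apply: n0; exists l.
pose X (b : bool) := if b then word w0 else (side_map (opp m) * word w0)%g.
pose p (b : bool) := if b then m else opp m.
have pX b l : l != p b -> 0 < side_form l (mv (X b) v).
  case: b => /=; first exact: hm.
  move=> lm; rewrite mvM (@side_form_gt0 _ _ (opp m)) ?mv_neq0 //; first by rewrite eq_sym.
  by rewrite side_form_side_map oppK oppr_le0.
(* The boolean chooses the side of [m] from which the point is seen. The letter without information
   is redirected to its opposite, so that the index set stays a full finite type. *)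
exists (fun i => X i.2), (fun i => if i.1 == p i.2 then opp (p i.2) else i.1).
split=> [[l b] /=|M H H0 hN w].
  by case: ifPn => [_|]; [apply: pX; exact: opp_neq | exact: pX].
have hX b l : l != p b -> H <= side_height l (X b * M)%g.
  by move=> /negPf lb; have := hN (l, b); rewrite /= lb.
(* The appended inverse of [w0] cancels the translation of [M]. *)
have [k hk] := @word_escape _ _ m (word w0 * M)%g H (w ++ rev (map opp w0)) H0
  (hX true) (fun l lm => eq_ind_r (fun g => H <= side_height l g) (hX false l lm) (mulgA _ _ _)).
exists k; move: hk; rewrite word_cat -word_inv -[(_ * _ * (_ * _))%g]mulgA mulKg //.
Qed.

End itineraries.

(** * Crossings of the sides along the flow *)

Section exponential_sums.
Variable R : realType.
Implicit Types a b s t : R.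

Definition exp_comb a b t : R := expR t * a + expR (- t) * b.

Lemma exp_combE a b t : exp_comb a b t = expR (- t) * (expR (t + t) * a + b).
Proof. by rewrite mulrDr mulrA -expRD addKr. Qed.

Lemma exp_comb_gt0 a b t : (0 < exp_comb a b t) = (0 < expR (t + t) * a + b).
Proof. by rewrite exp_combE pmulr_rgt0 // expR_gt0. Qed.

Lemma exp_comb_ge0 a b t : (0 <= exp_comb a b t) = (0 <= expR (t + t) * a + b).
Proof. by rewrite exp_combE pmulr_rge0 // expR_gt0. Qed.

Lemma exp_comb_root a b : a < 0 -> 0 < b -> exists t, exp_comb a b t = 0.
Proof.
move=> a0 b0; have ba : 0 < b / - a by rewrite divr_gt0 // oppr_gt0.
exists (ln (b / - a) / 2); rewrite exp_combE -splitr lnK ?posrE //.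
by rewrite invrN mulrN mulNr divfK ?lt_eqF // addNr mulr0.
Qed.

(* [exp_comb a b] has the sign of an affine function of [expR (t + t)]. *)
Lemma exp_comb_gt0_mono a b s t : 0 < b -> s < t -> 0 <= exp_comb a b t -> 0 < exp_comb a b s.
Proof.
move=> b0 st; rewrite exp_comb_gt0 exp_comb_ge0 => h.
have e0 := expR_gt0 (s + s).
have est : expR (s + s) < expR (t + t) by rewrite ltr_expR ltrD.
have [a0|a0] := leP 0 a; first by rewrite ltr_wpDl // mulr_ge0 // ltW.
by apply: le_lt_trans h _; rewrite ltrD2r ltr_nM2r.
Qed.

Lemma exp_comb_gt0_incr a b t : 0 < a -> 0 <= a + b -> 0 < t -> 0 < exp_comb a b t.
Proof.
move=> a0 ab t0; rewrite exp_comb_gt0; have : 1 < expR (t + t) by rewrite expR_gt1 addr_gt0.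
nra.
Qed.

Lemma exp_comb_large a b H : 0 < a -> exists2 T, 0 < T & forall t, T <= t -> H <= exp_comb a b t.
Proof.
move=> a0; exists ((`|H| + `|b| + 1) / a); first by rewrite divr_gt0 // ltr_wpDl // addr_ge0.
move=> t; rewrite ler_pdivrMr // => ht.
have t0 : 0 < t.
  by rewrite -(pmulr_lgt0 _ a0); apply: lt_le_trans ht; rewrite ltr_wpDl // addr_ge0.
have e1 : expR (- t) <= 1 by rewrite expR_le1 oppr_le0 ltW.
have e2 : 1 + t <= expR t := expR_ge1Dx t.
have e0 := expR_gt0 (- t).
have hH := ler_norm H; have hb : - b <= `|b| by rewrite -normrN ler_norm.
have b1 : - `|b| <= expR (- t) * b.
  have : expR (- t) * `|b| <= `|b| by rewrite ler_piMl.
  have : expR (- t) * - b <= expR (- t) * `|b| by rewrite ler_wpM2l // ltW.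
  lra.
have : (1 + t) * a <= expR t * a by rewrite ler_wpM2r // ltW.
rewrite /exp_comb; lra.
Qed.

End exponential_sums.

Section crossings.
Variables (R : realType) (D : schottky R).
Local Notation letter := ('I_(sch_q D) * bool)%type.
Local Notation opp := (@opp R D).
Implicit Types (k l m : letter) (v u : R * R) (M N : SL2 R) (w : seq letter).

Definition geod (t : R) : SL2 R := mkSL2 (diag_exp_subproof t).

Lemma col1_geod M t :
  col1 (M * geod t)%g = (expR (t / 2) * (col1 M).1, expR (t / 2) * (col1 M).2).
Proof.
rewrite col1M -mvZ; congr mv; rewrite /col1 /mv /= !mxE /=.
by rewrite !mulr1 !mulr0 !addr0 /= ?mulr0n ?mulr1n.
Qed.

Lemma col2_geod M t :
  col2 (M * geod t)%g = (expR (- (t / 2)) * (col2 M).1, expR (- (t / 2)) * (col2 M).2).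
Proof.
rewrite col2M -mvZ; congr mv; rewrite /col2 /mv /= !mxE /=.
by rewrite !mulr1 !mulr0 !add0r /= ?mulr0n ?mulr1n.
Qed.

Lemma side_form_col1_geod k M t : side_form k (col1 (M * geod t)%g) = expR t * side_form k (col1 M).
Proof. by rewrite col1_geod side_formZ expr2 -expRD -splitr. Qed.

Lemma side_height_geod k M t :
  side_height k (M * geod t)%g = exp_comb (side_form k (col1 M)) (side_form k (col2 M)) t.
Proof.
by rewrite /side_height side_form_col1_geod col2_geod side_formZ expr2 -expRD -opprD -splitr.
Qed.

(** The lift of C to matrices, by [sectionC_crossing]: the geodesic is leaving the disk [k] through
    its side. *)
Definition crossing M := exists2 k : letter, side_height k M = 0 & 0 < side_form k (col1 M).

Lemma col2_neq0 M : col2 M != (0, 0).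
Proof. by apply: mv_neq0; rewrite xpair_eqE oner_eq0 andbF. Qed.

(** The backward endpoint lies in the disk [k], hence outside all others. So the height above l <> k
    changes sign at most once, from positive to negative, and its sign at T controls all earlier
    times. *)
Lemma crossing_forward M k T : side_height k M = 0 -> 0 < side_form k (col1 M) ->
  (forall l, side_form l (col1 M) < 0 -> 0 <= side_height l (M * geod T)%g) ->
  forall t, 0 < t < T -> forall l, 0 < side_height l (M * geod t)%g.
Proof.
move=> hk0 qv hT t /andP[t0 tT] l; rewrite side_height_geod.
have qu : side_form k (col2 M) < 0 by move: hk0; rewrite /side_height; lra.
have [<-|kl] := eqVneq k l.
  by apply: exp_comb_gt0_incr => //; move: hk0; rewrite /side_height => ->.
have lu := side_form_gt0 kl (col2_neq0 M) (ltW qu).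
have [lv|lv] := leP 0 (side_form l (col1 M)).
  by rewrite exp_comb_gt0 ltr_wpDl // mulr_ge0 // expR_ge0.
by apply: (exp_comb_gt0_mono lu tT); rewrite -side_height_geod; exact: hT.
Qed.

(* From [M], the flow first leaves the fundamental domain through the side [l],
   at time [T]. *)
Definition next_side M l (T : R) := [/\ side_form l (col1 M) < 0, 0 < T,
  crossing (side_map (opp l) * (M * geod T))%g
  & forall s, 0 < s < T -> forall m, 0 < side_height m (M * geod s)%g].

(** The endpoints lie on different sides of [l], so the height above [l] has a root T, positive
    because that height is positive at time 0. The pairing turns the entry into the disk [l] into an
    exit from the disk [opp l]. *)
Lemma crossing_next M l : crossing M -> side_form l (col1 M) < 0 -> exists T, next_side M l T.
Proof.
move=> [k hk0 qv] lv.
have kl : k != l by apply: contraTneq lv => <-; rewrite -leNgt ltW.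
have qu : side_form k (col2 M) < 0 by move: hk0; rewrite /side_height; lra.
have lu := side_form_gt0 kl (col2_neq0 M) (ltW qu).
have [T hT] := exp_comb_root lv lu.
have T0 : 0 < T.
  rewrite ltNge; apply/negP => T0.
  have : 0 < side_height l M by rewrite (side_height_gt0 kl) // hk0.
  rewrite /side_height; move: hT; rewrite exp_combE => /eqP; rewrite mulf_eq0 gt_eqF ?expR_gt0 //=.
  have : expR (T + T) <= 1 by rewrite expR_le1; lra.
  have := expR_gt0 (T + T); move=> ? ? /eqP; nra.
exists T; split=> //.
  exists (opp l); first by rewrite side_height_side_map oppK side_height_geod hT oppr0.
  by rewrite col1M side_form_side_map oppK side_form_col1_geod oppr_gt0 pmulr_rlt0 // expR_gt0.
move=> t tT; apply: (crossing_forward hk0 qv _ tT) => m mv.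
have [->|ml] := eqVneq m l; first by rewrite side_height_geod hT.
by have := side_form_gt0 ml (col1_neq0 M) (ltW mv); rewrite ltNge ltW.
Qed.

Lemma crossing_last M t : crossing M -> (forall l, 0 <= side_form l (col1 M)) -> 0 < t ->
  forall m, 0 < side_height m (M * geod t)%g.
Proof.
move=> [k hk0 qv] hv t0; apply: (@crossing_forward M k (t + 1)) => //.
  by move=> l; rewrite ltNge hv.
by rewrite t0 ltrDl ltr01.
Qed.

Lemma crossing_near_forward M : crossing M ->
  exists2 eps, 0 < eps & forall t, 0 < t < eps -> forall l, 0 < side_height l (M * geod t)%g.
Proof.
move=> cM; have [[l lv]|nl] := pselect (exists l, side_form l (col1 M) < 0).
  by have [T [_ T0 _ hT]] := crossing_next cM lv; exists T.
exists 1 => // t /andP[t0 _]; apply: crossing_last => // l; rewrite leNgt.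
by apply/negP => lv; apply: nl; exists l.
Qed.

Fact rot_det : \det (\matrix_(i < 2, j < 2)
  (if i == j then 0 else if i == 0 then -1 else 1) : 'M[R]_2) = 1.
Proof. by rewrite det_mx22 !mxE /=; ring. Qed.

(* Right multiplication by the half-turn about i reverses the geodesic. *)
Lemma crossing_near_backward M : crossing M -> exists2 eps, 0 < eps &
  forall t, - eps < t < 0 -> exists w, forall l, 0 < side_height l (word w * (M * geod t))%g.
Proof.
move=> [k hk0 qv]; pose X := (side_map (opp k) * M)%g; pose J := mkSL2 rot_det.
have J1 N : col1 (N * J)%g = col2 N.
  by rewrite col1M; congr mv; rewrite /col1 /mv /= !mxE /=; congr pair; ring.
have J2 N l : side_form l (col2 (N * J)%g) = side_form l (col1 N).
  rewrite col2M /col1 -[in RHS](mul1r (side_form l _)) -(expr1n _ 2) -sqrrN -side_formZ -mvZ.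
  by congr (side_form l (mv N _)); rewrite /col2 /mv /= !mxE /=; congr pair; ring.
have qu : side_form k (col2 M) < 0 by move: hk0; rewrite /side_height; lra.
(* Seen through the pairing, the reversed geodesic leaves the disk [opp k]; its near future is the
   near past of [M]. *)
have cX : crossing (X * J)%g.
  exists (opp k); last by rewrite J1 col2M side_form_side_map oppK oppr_gt0.
  rewrite /side_height J1 J2 /X col1M col2M !side_form_side_map oppK.
  by move: hk0; rewrite /side_height; lra.
have [eps eps0 heps] := crossing_near_forward cX; exists eps => // t ht.
exists [:: opp k] => l /=; rewrite mulg1 mulgA -/X side_height_geod.
have := heps (- t) _ l; rewrite side_height_geod J1 J2 /exp_comb opprK addrC; apply.
by rewrite oppr_gt0 ltrNl andbC.
Qed.

Lemma crossing_discrete M : crossing M -> exists2 eps, 0 < eps &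
  forall t, `|t| < eps -> t != 0 -> exists w, forall l, 0 < side_height l (word w * (M * geod t))%g.
Proof.
move=> cM; have [e1 e10 h1] := crossing_near_forward cM.
have [e2 e20 h2] := crossing_near_backward cM.
exists (Num.min e1 e2) => [|t]; first by rewrite lt_min e10.
rewrite lt_min !ltr_norml => /andP[/andP[_ te1] /andP[te2 _]] t0.
have [tn|tp|t00] := ltgtP t 0; last by rewrite t00 eqxx in t0.
  by apply: h2; rewrite te2.
by exists [::] => l; rewrite mul1g h1 // tp.
Qed.

Lemma not_crossing w0 M : (forall l, 0 < side_height l (word w0 * M)%g) ->
  forall w, ~ crossing (word w * M)%g.
Proof.
move=> hM w [k /eqP hk0 _]; move: hk0; apply/negP.
have := word_fundamental_neq0 (w ++ rev (map opp w0)) k hM.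
by rewrite word_cat -word_inv mulgA mulgVK.
Qed.

(** Shortly after the crossings both geodesics are in the open fundamental domain, which a nonempty
    reduced word would move into a disk. *)
Lemma crossing_unique w M : crossing M -> crossing (word w * M)%g -> word w = 1%g.
Proof.
have [{}w rw ->] := word_reduced w => cM cwM.
have [->//|w0] := eqVneq w [::].
have [e1 e10 h1] := crossing_near_forward cM.
have [e2 e20 h2] := crossing_near_forward cwM.
pose t := Num.min e1 e2 / 2.
have m0 : 0 < Num.min e1 e2 by rewrite lt_min e10.
have t0 : 0 < t by rewrite divr_gt0.
have tm : t < Num.min e1 e2 by rewrite /t; lra.
move: tm; rewrite lt_min => /andP[te1 te2].
have [|k hk] := @word_fundamental _ _ w (M * geod t)%g _ rw w0.
  by apply: h1; rewrite t0.
have := h2 t _ k; rewrite t0 te2 -mulgA => /(_ isT).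
by rewrite ltNge ltW.
Qed.

(** A disk translate containing the forward endpoint but not the backward one must be entered at
    some time t, possibly negative. *)
Lemma infinite_itin_crossing M : infinite_itin D (col1 M) -> exists w t,
  crossing (word w * M * geod t)%g /\ infinite_itin D (col1 (word w * M * geod t)%g).
Proof.
move=> iM; have [w [l [iw lv lu]]] := infinite_itin_separate (col_det M) iM.
rewrite -col1M in iw lv; rewrite -col2M in lu.
have [t ht] := exp_comb_root lv lu.
exists (opp l :: w), t; rewrite /= -!mulgA.
set X := (_ * (M * _))%g; have XE : X = ((word w * M) * geod t)%g by rewrite /X mulgA.
split.
  exists (opp l); first by rewrite side_height_side_map oppK XE side_height_geod ht oppr0.
  by rewrite col1M side_form_side_map oppK XE side_form_col1_geod oppr_gt0 pmulr_rlt0 // expR_gt0.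
move=> n; rewrite col1M XE; apply: (@infinite_itin_next _ _ l _ _ _ _ n).
- exact: col1_neq0.
- by rewrite side_form_col1_geod pmulr_rlt0 // expR_gt0.
- by move=> p; rewrite col1_geod; apply: itinZ (iw p); rewrite gt_eqF // expR_gt0.
Qed.

(** The finitely many heights of [not_infinite_itin_escape] all tend to infinity along the ray. *)
Lemma not_infinite_itin_ray M H : ~ infinite_itin D (col1 M) ->
  exists t, forall w, exists k, H <= `|side_height k (word w * (M * geod t))%g|.
Proof.
move=> niM; have [N [f [hf esc]]] := not_infinite_itin_escape (col1_neq0 M) niM.
have large i : exists T : R, forall t, T <= t -> `|H| <= side_height (f i) (N i * (M * geod t))%g.
  have [T _ hT] := exp_comb_large (side_form (f i) (col2 (N i * M)%g)) `|H| (hf i).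
  by exists T => t /hT; rewrite mulgA side_height_geod col1M.
have [T hT] := choice large.
have [t _ ht] := finite_upper_bound T 0.
exists t => w; have [k hk] := esc (M * geod t)%g `|H| (normr_ge0 _)
  (fun i => hT i t (ltW (ht i))) w.
by exists k; rewrite (le_trans (ler_norm _)).
Qed.

End crossings.

(** * The upper half-plane and the sides in terms of disk forms *)

Lemma homography_comp (K : fieldType) (a b c d a' b' c' d' w : K) :
  (c * a' + d * c') * w + (c * b' + d * d') != 0 -> c' * w + d' != 0 ->
  ((a * a' + b * c') * w + (a * b' + b * d')) /
    ((c * a' + d * c') * w + (c * b' + d * d')) =
  (a * ((a' * w + b') / (c' * w + d')) + b) /
    (c * ((a' * w + b') / (c' * w + d')) + d).
Proof.
move=> n2 n3; field; rewrite n3 /=; apply: contra_neq n2 => e.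
by rewrite -[RHS]e; ring.
Qed.

Section half_plane.
Variable R : realType.
Implicit Types (M N : SL2 R) (g : PSL2 R) (z : Hplane R).

Lemma val_act_H M z :
  val (act_H (psl M) z) = flt_num M (val z) / flt_den M (val z).
Proof.
have := act_H_sphere (psl M) z.
by rewrite act_sphere_psl /= (negPf (flt_den_neq0 _ (Hplane_gt0 z))) => -[].
Qed.

Lemma act_HM g h z : act_H (g * h)%g z = act_H g (act_H h z).
Proof.
rewrite -[g]pslK -[h]pslK -pslM; move: (repr g) (repr h) => M N.
apply: val_inj; rewrite !val_act_H.
have := flt_den_neq0 N (Hplane_gt0 z).
have := flt_den_neq0 (M * N)%g (Hplane_gt0 z).
rewrite /flt_num /flt_den /= !mulmx22 !rmorphD !rmorphM /=.
exact: homography_comp.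
Qed.

Lemma half_plane_eq z1 z2 : complex.Re (val z1) = complex.Re (val z2) ->
  complex.Im (val z1) = complex.Im (val z2) -> z1 = z2.
Proof.
move=> hRe hIm; apply: val_inj; move: hRe hIm.
by case: (val z1) (val z2) => [x y] [x' y'] /= -> ->.
Qed.

(** This is |c i + d|^2, the inverse of the imaginary part of g(i). *)
Definition height M : R := val M 1 0 ^+ 2 + val M 1 1 ^+ 2.

Lemma height_gt0 M : 0 < height M.
Proof.
have dt := det_SL2_entries M; rewrite lt_neqAle addr_ge0 ?sqr_ge0 // andbT eq_sym.
rewrite paddr_eq0 ?sqr_ge0 // !sqrf_eq0; apply/negP => /andP[/eqP c0 /eqP d0].
by move: dt; rewrite c0 d0 !mulr0 subrr => /eqP; rewrite eq_sym oner_eq0.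
Qed.

Lemma act_H_base M :
  val (act_H (psl M) (base_i R)) =
  ((val M 0 0 * val M 1 0 + val M 0 1 * val M 1 1) / height M) +i* (height M)^-1.
Proof.
rewrite val_act_H; have d0 := flt_den_neq0 M (Hplane_gt0 (base_i R)).
have n0 := gt_eqF (height_gt0 M).
apply: (mulIf d0); rewrite divfK // /flt_num /flt_den.
have dt := det_SL2_entries M; rewrite /height in n0 *.
move: dt n0; move: (val M 0 0) (val M 0 1) (val M 1 0) (val M 1 1) => a b c d dt n0.
apply/eqP; rewrite eq_complex /= !(mul0r, mulr0, mulr1, add0r, addr0, subr0, sub0r).
have det1 x : x = x * (a * d - b * c) by rewrite dt mulr1.
apply/andP; split; apply/eqP.
  by rewrite [X in _ = _ - X]det1; field; rewrite n0.
by rewrite [X in _ = _ + X]det1; field; rewrite n0.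
Qed.

Lemma act_H_base_transitive z : exists M, z = act_H (psl M) (base_i R).
Proof.
have := Hplane_gt0 z; case e : (val z) => [x y] /= y0.
have s0 : 0 < Num.sqrt y by rewrite sqrtr_gt0.
have s2 : Num.sqrt y ^+ 2 = y by rewrite sqr_sqrtr // ltW.
(* The affine map sending w to y w + x, normalised to determinant 1. *)
pose A : 'M[R]_2 := \matrix_(i, j)
  (if i == 0 then (if j == 0 then Num.sqrt y else x / Num.sqrt y)
   else if j == 0 then 0 else (Num.sqrt y)^-1).
have dA : \det A = 1 by rewrite det_mx22 !mxE /= mulr0 subr0 divff ?gt_eqF.
exists (mkSL2 dA); apply: half_plane_eq; rewrite act_H_base e /height /= !mxE /=.
  by rewrite mulr0 add0r expr0n add0r; field; rewrite gt_eqF.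
by rewrite expr0n add0r exprVn invrK s2.
Qed.

End half_plane.

Section section_bridge.
Variables (R : realType) (D : schottky R).
Local Notation letter := ('I_(sch_q D) * bool)%type.
Implicit Types (k l m : letter) (v u : R * R) (M N : SL2 R) (w : seq letter).

(** The height depends on [M] only through z = g(i): it is the Hermitian extension of the form at
    (z, 1), divided by Im z. This links the algebra of columns with the topology of the
    half-plane. *)
Lemma side_height_point l N M (z := val (act_H (psl M) (base_i R))) :
  side_height l (N * M)%g * complex.Im z =
    side_form l (mv N (complex.Re z, 1)) + complex.Im z ^+ 2 * side_form l (mv N (1, 0)).
Proof.
have r0 := sch_radius_gt0 l; have n0 := height_gt0 M; have dt := det_SL2_entries M.
rewrite /z act_H_base /= -[in X in _ + X ^+ 2 * _](mul1r (height M)^-1) -[1 in X in _ + X * _]dt.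
rewrite /side_height col1M col2M /col1 /col2 /mv /= /side_form /disk_form /= /height.
rewrite /height in n0.
by field; rewrite !gt_eqF.
Qed.

Lemma half_circleE c r (z : Hplane R) : 0 < r -> half_circle c r z <->
  (complex.Re (val z) - c) ^+ 2 + complex.Im (val z) ^+ 2 = r ^+ 2.
Proof.
move=> r0; rewrite /half_circle /=; case: (sval z) => x y /=; rewrite subc_real.
by split=> /eqP h; apply/eqP; move: h; rewrite eqr_normc.
Qed.

Lemma side_height_eq0 k M : side k (act_H (psl M) (base_i R)) <-> side_height k M = 0.
Proof.
have r0 := sch_radius_gt0 k; have := side_height_point k 1%g M; rewrite mul1g mv1.
have := Hplane_gt0 (act_H (psl M) (base_i R)).
rewrite /side half_circleE //; set x := complex.Re _; set y := complex.Im _ => y0 e.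
have {}e : side_height k M * y =
    ((x - sch_center k) ^+ 2 + y ^+ 2 - sch_radius k ^+ 2) / sch_radius k.
  by rewrite e mv1 /side_form /disk_form /=; ring.
split=> h.
  by apply: (mulIf (lt0r_neq0 y0)); rewrite e h subrr !mul0r.
move: e; rewrite h mul0r => /esym/eqP; rewrite mulf_eq0 invr_eq0 (gt_eqF r0) orbF.
by rewrite subr_eq0 => /eqP.
Qed.

Lemma act_sphere_infty M : act_sphere (psl M) (infty R) =
  if (col1 M).2 == 0 then infty R else fin_pt ((col1 M).1 / (col1 M).2)%:C.
Proof. by rewrite act_sphere_psl flt_infty /col1 /mv /= !mulr1 !mulr0 !addr0. Qed.

Lemma forward_interval_side_form k M :
  forward_interval k (act_sphere (psl M) (infty R)) <-> 0 < side_form k (col1 M).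
Proof.
have r0 := sch_radius_gt0 k; rewrite act_sphere_infty; move: (col1_neq0 M).
case: (col1 M) => x y xy0; rewrite /forward_interval /setD /=.
rewrite /side_form /disk_form /= pmulr_lgt0 ?invr_gt0 // subr_gt0.
case: ifPn => [/eqP y0|y0].
  rewrite y0 !mulr0 subr0 expr0n mulr0 exprn_even_gt0 //=; split=> [_|x0].
    by move: xy0; rewrite y0 xpair_eqE eqxx andbT.
  by split=> //; exact: infty_imageE.
have y2 : 0 < y ^+ 2 by rewrite exprn_even_gt0.
have -> : ((x - sch_center k * y) ^+ 2 > sch_radius k ^+ 2 * y ^+ 2) =
    ~~ ((x / y - sch_center k) ^+ 2 <= sch_radius k ^+ 2).
  have -> : x - sch_center k * y = (x / y - sch_center k) * y by rewrite mulrBl divfK.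
  by rewrite exprMn ltr_pM2r // ltNge.
split=> [[_ h]|/negP h].
  apply/negP => hle; apply: h; apply/fin_pt_imageE/closed_diskE => //=.
  by rewrite expr0n addr0.
split=> // /fin_pt_imageE/closed_diskE; rewrite /= expr0n addr0 => /(_ r0) hle.
by apply: h.
Qed.

Lemma sectionC_crossing M : sectionC D (psl M) <-> crossing D M.
Proof.
split=> [[k [/side_height_eq0 hk0 /forward_interval_side_form qk0]]|[k hk0 qk0]].
  by exists k.
by exists k; split; [apply/side_height_eq0 | apply/forward_interval_side_form].
Qed.

End section_bridge.

(** * Limit set *)

Section sphere_neighbourhoods.
Variable R : realType.
Implicit Types (x y e rho H : R).

Definition box (z : Cplx R) e : set (Cplx R) :=
  [set w | `|complex.Re w - complex.Re z| < e /\ `|complex.Im w - complex.Im z| < e].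

Lemma ltr_norm_sqr (a e : R) : 0 < e -> (`|a| < e) = (a ^+ 2 < e ^+ 2).
Proof. by move=> e0; rewrite -(real_normK (num_real a)) ltr_pXn2r ?nnegrE // ltW. Qed.

Lemma nbhs_box (z : Cplx R) e : 0 < e -> nbhs z (box z e).
Proof.
move=> e0; apply/nbhs_ballP; exists e%:C; first by rewrite /= ltcR.
case: z => x y [x' y']; rewrite -ball_normE /ball_ /box /=.
rewrite (_ : (x +i* y) - (x' +i* y') = (x - x') +i* (y - y')) // ltr_normc // => h.
rewrite !ltr_norm_sqr //; have := sqr_ge0 (x - x'); have := sqr_ge0 (y - y').
by move: h; rewrite -(sqrrN (x' - x)) -(sqrrN (y' - y)) !opprB; lra.
Qed.

Lemma box_nbhs (z : Cplx R) (U : set (Cplx R)) : nbhs z U ->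
  exists2 e, 0 < e & box z e `<=` U.
Proof.
move=> /nbhs_ballP[[e e'] /=]; rewrite ltcE /= => /andP[/eqP -> e0] zU.
exists (e / 2); first by rewrite divr_gt0.
case: z zU => x y zU [x' y'] [/= hx hy]; apply: zU; rewrite -ball_normE /ball_ /=.
rewrite (_ : (x +i* y) - (x' +i* y') = (x - x') +i* (y - y')) //.
rewrite -[e +i* 0]/(e%:C) ltr_normc //.
have e2 : 0 < e / 2 by rewrite divr_gt0.
move: hx hy; rewrite !ltr_norm_sqr // -(sqrrN (x' - x)) -(sqrrN (y' - y)) !opprB.
rewrite expr_div_n; have : 0 < e ^+ 2 by rewrite exprn_gt0.
lra.
Qed.

Lemma compact_box rho : compact
  [set w : Cplx R | `|complex.Re w| <= rho /\ `|complex.Im w| <= rho].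
Proof.
pose f (p : R * R) : Cplx R := p.1 +i* p.2.
have cf : continuous f.
  move=> [x y] U /box_nbhs[e e0 eU].
  exists (ball x e, ball y e); first by split; exact: nbhsx_ballx.
  move=> [x' y'] /= [hx hy]; apply: eU; split => /=; rewrite distrC.
    exact: hx.
  exact: hy.
have sc : compact `[- rho, rho]%classic by exact: segment_compact.
have := continuous_compact (continuous_subspaceT cf) (compact_setX sc sc).
congr (compact _); apply/seteqP; split=> [_ [[x y] /= [hx hy] <-]|[x y] /= [hx hy]].
  by move: hx hy; rewrite !in_itv /= !ler_norml.
by exists (x, y) => //=; rewrite !in_itv /= -!ler_norml.
Qed.

Lemma nbhs_sphere_infty rho : nbhs (infty R)
  [set s : sphere R | forall w, s = fin_pt w ->
     rho < `|complex.Re w| \/ rho < `|complex.Im w|].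
Proof.
have cpt := @compact_box rho.
exists [set w : Cplx R | `|complex.Re w| <= rho /\ `|complex.Im w| <= rho].
  by split=> //; apply: compact_closed => //; exact: norm_hausdorff.
move=> s [[z hz <-] w [<-]|->//].
have [h|h] := leP `|complex.Re z| rho; last by left.
have [h'|h'] := leP `|complex.Im z| rho; last by right.
by case: hz.
Qed.

Lemma quadratic_near_real (a b c x0 H : R) : 0 < a * x0 ^+ 2 + 2 * b * x0 + c ->
  exists2 e, 0 < e & forall x y, `|x - x0| < e -> 0 < y < e ->
    H * y <= a * (x ^+ 2 + y ^+ 2) + 2 * b * x + c.
Proof.
(* [K] adds up the variations of all terms per unit of e, including H y, so that e = d / (2 K) keeps
   them below the positive value [d]. *)
set d := _ + c => d0; pose K := 2 * `|a| + 2 * `|a| * `|x0| + 2 * `|b| + `|H| + 1.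
have K1 : 1 <= K by rewrite /K lerDr !addr_ge0 // !mulr_ge0.
have K0 : 0 < K by rewrite (lt_le_trans ltr01).
exists (Num.min 1 (d / (2 * K))) => [|x y].
  by rewrite lt_min ltr01 divr_gt0 // mulr_gt0.
set e := Num.min _ _; have e1 : e <= 1 by rewrite ge_min lexx.
have eK : e * (2 * K) <= d by rewrite -ler_pdivlMr ?mulr_gt0 // ge_min lexx orbT.
move=> hx /andP[y0 ye]; pose t := x - x0.
have -> : a * (x ^+ 2 + y ^+ 2) + 2 * b * x + c =
    d + (a * t ^+ 2 + 2 * (a * x0 * t) + a * y ^+ 2 + 2 * (b * t)).
  by rewrite /d /t; ring.
have te : `|t| <= e := ltW hx.
have e0 : 0 <= e by rewrite (le_trans (normr_ge0 t)).
have low (p q s : R) : `|p * q| <= s -> - s <= p * q.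
  by move=> h; rewrite lerNl (le_trans _ h) // -normrN ler_norm.
have sq (p : R) : `|p| <= e -> `|p ^+ 2| <= e.
  move=> pe; rewrite normrX expr2 -[leRHS]mul1r ler_pM // (le_trans pe) //.
have ye' : `|y| <= e by rewrite gtr0_norm // ltW.
have h1 : - (`|a| * e) <= a * t ^+ 2.
  by apply: low; rewrite normrM ler_wpM2l // sq.
have h2 : - (`|a| * `|x0| * e) <= a * x0 * t.
  by apply: low; rewrite !normrM ler_wpM2l // mulr_ge0.
have h3 : - (`|a| * e) <= a * y ^+ 2.
  by apply: low; rewrite normrM ler_wpM2l // sq.
have h4 : - (`|b| * e) <= b * t by apply: low; rewrite normrM ler_wpM2l.
have h5 : H * y <= `|H| * e.
  by rewrite (le_trans (ler_norm _)) // normrM ler_wpM2l.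
move: eK; rewrite /K; move: h1 h2 h3 h4 h5.
have h6 : 0 <= `|H| * e by rewrite mulr_ge0.
have h7 : 0 <= `|a| * e by rewrite mulr_ge0.
have h8 : 0 <= `|b| * e by rewrite mulr_ge0.
have h9 : 0 <= `|a| * `|x0| * e by rewrite !mulr_ge0.
lra.
Qed.

Lemma quadratic_near_infty (a b c H : R) : 0 < a ->
  exists rho, forall x y, (rho < `|x| \/ rho < `|y|) ->  0 < y ->
    H * y <= a * (x ^+ 2 + y ^+ 2) + 2 * b * x + c.
Proof.
(* [K] collects the terms that are at most linear in m = max |x| |y|; beyond K / a + 1 they are
   dominated by a m^2. *)
move=> a0; pose K := 2 * `|b| + `|c| + `|H|.
exists (K / a + 1) => x y hxy y0; pose m := Num.max `|x| `|y|.
have xm : `|x| <= m by rewrite le_max lexx.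
have ym : `|y| <= m by rewrite le_max lexx orbT.
have K0 : 0 <= K by rewrite !addr_ge0 // mulr_ge0.
have hm : K / a + 1 < m by rewrite lt_max; case: hxy => ->; rewrite ?orbT.
have Ka : 0 <= K / a by rewrite divr_ge0 // ltW.
have m1 : 1 < m by lra.
have Km : K <= a * m by rewrite mulrC -ler_pdivrMr //; lra.
have m2 : m ^+ 2 <= x ^+ 2 + y ^+ 2.
  rewrite /m maxEle; case: ifP => _; rewrite real_normK ?num_real // ?lerDl ?lerDr ?sqr_ge0 //.
have h1 : a * m ^+ 2 <= a * (x ^+ 2 + y ^+ 2) by rewrite ler_pM2l.
have h2 : - (`|b| * m) <= b * x.
  rewrite lerNl (@le_trans _ _ `|b * x|) //; first by rewrite -normrN ler_norm.
  by rewrite normrM ler_wpM2l.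
have h3 : - (`|c| * m) <= c.
  rewrite lerNl (@le_trans _ _ `|c|) //; first by rewrite -normrN ler_norm.
  by rewrite ler_peMr // ltW.
have h4 : H * y <= `|H| * m.
  by rewrite (le_trans (ler_norm _)) // normrM ler_wpM2l.
have h5 : K * m <= a * m ^+ 2 by rewrite expr2 mulrA ler_wpM2r // ltW // (lt_trans _ m1).
move: h5; rewrite /K; lra.
Qed.

End sphere_neighbourhoods.

Section limit_set_itineraries.
Variables (R : realType) (D : schottky R).
Local Notation letter := ('I_(sch_q D) * bool)%type.
Implicit Types (k l m : letter) (v u : R * R) (M N : SL2 R) (w : seq letter).

Lemma side_form_mv_coef l N : exists a b c, forall v,
  side_form l (mv N v) = a * v.1 ^+ 2 + 2 * b * v.1 * v.2 + c * v.2 ^+ 2.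
Proof.
pose p := val N 0 0 - sch_center l * val N 1 0.
pose q := val N 0 1 - sch_center l * val N 1 1.
pose r := sch_radius l.
exists ((p ^+ 2 - r ^+ 2 * val N 1 0 ^+ 2) / r).
exists ((p * q - r ^+ 2 * val N 1 0 * val N 1 1) / r).
exists ((q ^+ 2 - r ^+ 2 * val N 1 1 ^+ 2) / r) => -[x y].
by rewrite /side_form /disk_form /mv /= -/r /p /q; ring.
Qed.

(** Heights tend to infinity at boundary points outside the closed disk: in [side_height_point] the
    right-hand side stays positive near a real point, where Im z tends to 0, and grows quadratically
    near infinity. *)
Lemma side_height_ge_near l N H M : 0 < side_form l (mv N (col1 M)) ->
  \forall s \near act_sphere (psl M) (infty R),
    forall P, s = fin_pt (val (act_H (psl P) (base_i R))) -> H <= side_height l (N * P)%g.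
Proof.
have [a [b [c abc]]] := side_form_mv_coef l N; rewrite abc act_sphere_infty.
have hP P (x := complex.Re (val (act_H (psl P) (base_i R))))
    (y := complex.Im (val (act_H (psl P) (base_i R)))) :
    H * y <= a * (x ^+ 2 + y ^+ 2) + 2 * b * x + c -> H <= side_height l (N * P)%g.
  have y0 : 0 < y := Hplane_gt0 _; move=> h; rewrite -(ler_pM2r y0) (le_trans h) //.
  have := side_height_point l N P; cbv zeta; rewrite -/x -/y !abc => ->.
  by move: x y {y0 h} => x y /=; lra.
move: (col1 M) => [v1 v2] /=; case: ifPn => [/eqP ->|v20].
  rewrite mulr0 expr0n mulr0 !addr0 => av.
  have a0 : 0 < a.
    by rewrite ltNge; apply/negP => a0; move: av; rewrite ltNge mulr_le0_ge0 ?sqr_ge0.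
  have [rho hrho] := quadratic_near_infty b c H a0.
  apply: filterS (nbhs_sphere_infty rho) => s hs P /hs h; apply: hP; apply: hrho => //.
  exact: Hplane_gt0.
move=> av; have av' : 0 < a * (v1 / v2) ^+ 2 + 2 * b * (v1 / v2) + c.
  have v22 : 0 < v2 ^+ 2 by rewrite exprn_even_gt0.
  rewrite -(pmulr_lgt0 _ v22); congr (0 < _): av; by field.
have [e e0 he] := quadratic_near_real H av'.
have := @one_point_compactification_some_nbhs (Cplx R) _ _ (nbhs_box ((v1 / v2)%:C : Cplx R) e0).
apply: filterS => s [z [hx hy] <-] P zP.
have zE : z = val (act_H (psl P) (base_i R)) by case: zP.
rewrite zE in hx hy; apply: hP; apply: he => //.
have y0 := Hplane_gt0 (act_H (psl P) (base_i R)); rewrite y0 /=.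
by move: hy; rewrite /= subr0 gtr0_norm.
Qed.

(** [H] exceeds all heights of i. An orbit point g(i) close to the endpoint would meet the escape
    conditions, and translating it back by the inverse of g would give i a height of absolute value
    at least [H]. *)
Lemma not_infinite_itin_limit M : ~ infinite_itin D (col1 M) ->
  ~ limit_set (schottky_group D) (act_sphere (psl M) (infty R)).
Proof.
move=> niM [_ /(_ (base_i R)) lim].
have [N [f [hf esc]]] := not_infinite_itin_escape (col1_neq0 M) niM.
have [H H0 hH] := finite_upper_bound (fun k : letter => `|side_height k (1%g : SL2 R)|) 0.
have /lim[_ [_ [g Gg <-] /= hg]] :
    \forall s \near act_sphere (psl M) (infty R), forall i,
    forall P, s = fin_pt (val (act_H (psl P) (base_i R))) -> H <= side_height (f i) (N i * P)%g.
  apply: (@filter_forall _ _ _ _ (@nbhs_filter (sphere R) _)) => i.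
  exact: side_height_ge_near.
have [w _ gw] := schottky_groupP Gg; rewrite gw in hg.
have [k] := esc (word w) H (ltW H0) (fun i => hg i _ erefl) (rev (map (@opp R D) w)).
by rewrite -word_inv mulVg leNgt hH.
Qed.

(** Here x + i t is an orbit point, y a point of a nested disk of radius 1 / A centred at - b / A,
    and the last hypothesis bounds the height above that disk by H. Both conclusions are distances
    of order 1 / A. *)
Lemma orbit_point_bound (A a x y b t H : R) : 0 <= H -> 0 < t -> 0 < A ->
  a = A * x + b -> (A * y + b) ^+ 2 <= 1 ->
  a ^+ 2 + (A * t) ^+ 2 - 1 <= H * (A * t) ->
  A * `|x - y| <= H + 2 /\ A * t <= H + 1.
Proof.
move=> H0 t0 A0 -> hy; set s := A * t => h.
have s0 : 0 < s by rewrite mulr_gt0.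
have sH : s <= H + 1.
  rewrite leNgt; apply/negP => sH; have := sqr_ge0 (A * x + b) => ?.
  have : 1 < s * (s - H) by rewrite -[ltLHS]mulr1 ltr_pM //; lra.
  lra.
split=> //.
have le_abs (p q : R) : 0 <= q -> p ^+ 2 <= q ^+ 2 -> `|p| <= q.
  by move=> q0; rewrite -(real_normK (num_real p)) ler_pXn2r ?nnegrE.
have hx : `|A * x + b| <= H + 1.
  apply: le_abs; first by rewrite addr_ge0.
  have : H * s <= H * (H + 1) by rewrite ler_wpM2l.
  have := sqr_ge0 s; rewrite sqrrD; lra.
have {}hy : `|A * y + b| <= 1 by apply: le_abs => //; rewrite expr1n.
rewrite -[A in leLHS]gtr0_norm // -normrM.
have -> : A * (x - y) = (A * x + b) - (A * y + b) by ring.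
by rewrite (le_trans (ler_normB _ _)) //; lra.
Qed.

(** The point w^-1 z has the same height above the nested disk w^-1 D_l as z above D_l, hence at
    most [H], while that disk contains x and has radius 1 / A. Taking A > (H + 2) / e puts w^-1 z
    within e of x in each coordinate. *)
Lemma infinite_itin_limit M : infinite_itin D (col1 M) ->
  limit_set (schottky_group D) (act_sphere (psl M) (infty R)).
Proof.
move=> iM; rewrite act_sphere_infty; have v0 := col1_neq0 M.
move: (col1 M) v0 iM => v v0 iv.
(* Infinity has no infinite itinerary: with v.2 = 0 the completed square makes A times a negative
   form value a square. *)
have v2 : v.2 != 0.
  have [w [l [_ lv A0]]] := infinite_itin_growth 0 v0 iv.
  have [b hb] := side_form_mv_square l (word w).
  apply/eqP => v2; have := hb v; rewrite v2 mulr0 expr0n subr0 addr0 => e.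
  have : 0 <= (side_form l (mv (word w) (1, 0)) * v.1) ^+ 2 by rewrite sqr_ge0.
  by rewrite -e pmulr_rge0 // leNgt lv.
rewrite (negPf v2); split=> // z U; set x := v.1 / v.2 => /box_nbhs[e e0 eU].
have [N0 zN] := act_H_base_transitive z.
have [H H0 hH] := finite_upper_bound (fun k : letter => side_height k N0) 0.
have [w [l [_ lv]]] := infinite_itin_growth ((H + 2) / e) v0 iv.
have [b hb] := side_form_mv_square l (word w).
set A := side_form l (mv (word w) (1, 0)) in hb * => hA.
have A0 : 0 < A by apply: lt_trans hA; rewrite divr_gt0 // addr_gt0.
set y := act_H (psl (word w)^-1%g) z.
exists (fin_pt (val y)); split.
- apply/eqP => e1; have {e1} yx : val y = x%:C by case: e1.
  by have := Hplane_gt0 y; rewrite yx /= ltxx.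
- exists (psl (word w)^-1%g) => //; rewrite pslV; apply: schottky_groupV.
  exact: schottky_group_word.
have yE : y = act_H (psl ((word w)^-1 * N0)%g) (base_i R) by rewrite pslM act_HM -zN.
have t0 := Hplane_gt0 y.
have hN : side_height l N0 = side_height l (word w * ((word w)^-1 * N0))%g by rewrite mulVKg.
have := side_height_point l (word w) ((word w)^-1 * N0)%g; cbv zeta; rewrite -hN -yE -/A.
set s := complex.Re _ in t0 *; set t := complex.Im _ in t0 * => hs.
have := hb (s, 1); rewrite /= mulr1 expr1n => hbs.
have hbx : (A * x + b) ^+ 2 <= 1.
  have v22 : 0 < v.2 ^+ 2 by rewrite exprn_even_gt0.
  rewrite -(ler_pM2r v22) -exprMn mul1r.
  have -> : (A * x + b) * v.2 = A * v.1 + b * v.2 by rewrite /x; field.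
  by rewrite -subr_le0 -hb pmulr_rle0 // ltW.
have [|h1 h2] := orbit_point_bound (ltW H0) t0 A0 erefl hbx (x := s).
  have : A * (side_height l N0 * t) <= H * (A * t).
    by rewrite mulrCA ler_wpM2r ?(ltW (hH l)) // mulr_ge0 ?ltW.
  by rewrite hs mulrDr hbs; lra.
apply: eU; split => /=; rewrite -/s -/t.
  rewrite -(ltr_pM2l A0); apply: le_lt_trans h1 _.
  by rewrite -ltr_pdivrMr.
rewrite subr0 gtr0_norm // -(ltr_pM2l A0); apply: le_lt_trans h2 _.
by move: hA; rewrite ltr_pdivrMr //; lra.
Qed.

Lemma limit_set_itin M :
  limit_set (schottky_group D) (act_sphere (psl M) (infty R)) <->
  infinite_itin D (col1 M).
Proof.
split=> [|/infinite_itin_limit //]; apply: contraPP => /not_infinite_itin_limit.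
by [].
Qed.

End limit_set_itineraries.

(** * Quotients *)

Section orbits.
Variables (gT : groupType) (T : topologicalType) (act : gT -> T -> T).
Variable Gamma : set gT.
Hypothesis act1 : forall x, act 1%g x = x.
Hypothesis actM : forall g h x, act (g * h)%g x = act g (act h x).
Hypothesis Gamma1 : Gamma 1%g.
Hypothesis GammaM : forall g h, Gamma g -> Gamma h -> Gamma (g * h)%g.
Hypothesis GammaV : forall g, Gamma g -> Gamma g^-1%g.

Lemma orbit_piE x y :
  orbit_pi act Gamma x = orbit_pi act Gamma y <-> exists2 c, Gamma c & y = act c x.
Proof.
rewrite orbit_piP; split=> [e|[c Gc ->]].
  have : orbit_set act Gamma y y by exists 1%g.
  by rewrite -e => -[c Gc <-]; exists c.
apply/seteqP; split=> _ [d Gd <-].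
  by exists (d * c^-1)%g; [apply: GammaM => //; exact: GammaV | rewrite -actM mulgVK].
by exists (d * c)%g; [exact: GammaM | rewrite actM].
Qed.

Lemma open_orbit_saturation (U : set T) :
  (forall c, Gamma c -> open (act c @^-1` U)) ->
  open (orbit_pi act Gamma @` U : set (orbit_space act Gamma)).
Proof.
move=> oU; rewrite /open /= /quotient_open.
rewrite (_ : _ @^-1` _ = \bigcup_(c in Gamma) (act c @^-1` U)).
  exact: bigcup_open.
apply/seteqP; split=> x /=.
  by move=> [u Uu] /esym/orbit_piE[c Gc uE]; exists c => //; rewrite /preimage /= -uE.
by move=> [c Gc Ucx]; exists (act c x) => //; apply/esym/orbit_piE; exists c.
Qed.

End orbits.

Section topology.
Variable R : realType.
Implicit Types (M N : SL2 R) (z : Hplane R).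

Lemma SL2_entry_continuous (i j : 'I_2) : continuous (fun M : SL2 R => val M i j).
Proof.
move=> M; apply: (@continuous_comp _ _ _ (fun M : SL2 R => val M) (fun A : 'M[R]_2 => A i j)).
  exact: initial_continuous.
exact: coord_continuous.
Qed.

(** Squaring removes the sign ambiguity of the lift; on a_t the value is e^t, so this continuous
    function recovers t. *)
Definition entry_sq (g : PSL2 R) : R := val (repr g) 0 0 ^+ 2.

Lemma entry_sq_psl M : entry_sq (psl M) = val M 0 0 ^+ 2.
Proof.
rewrite /entry_sq; have /pm_eqP[b ->] := repr_psl M.
by rewrite mxE exprMn sqrr_sign mul1r.
Qed.

Lemma entry_sq_continuous : continuous entry_sq.
Proof.
apply: (@repr_comp_continuous _ _ _ (fun M : SL2 R => val M 0 0 ^+ 2)).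
  move=> M; apply: (@continuous_comp _ _ _ (fun M : SL2 R => val M 0 0) (fun x : R => x ^+ 2)).
    exact: SL2_entry_continuous.
  exact: exprn_continuous.
by move=> M N /eqP MN; rewrite -!entry_sq_psl; apply/eqP; congr entry_sq.
Qed.

Lemma Re_continuous : continuous (fun z => complex.Re (val z)).
Proof.
move=> z; apply: (@continuous_comp _ _ _ (fun z : Hplane R => val z) (@complex.Re R : Cplx R -> R)).
  exact: initial_continuous.
move=> U /nbhs_ballP[e e0 eU].
apply: filterS (nbhs_box (val z : Cplx R) e0) => w [hw _].
by apply: eU; rewrite -ball_normE /ball_ /= distrC.
Qed.

Lemma Im_continuous : continuous (fun z => complex.Im (val z)).
Proof.
move=> z; apply: (@continuous_comp _ _ _ (fun z : Hplane R => val z) (@complex.Im R : Cplx R -> R)).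
  exact: initial_continuous.
move=> U /nbhs_ballP[e e0 eU].
apply: filterS (nbhs_box (val z : Cplx R) e0) => w [_ hw].
by apply: eU; rewrite -ball_normE /ball_ /= distrC.
Qed.

End topology.

Lemma rational_continuous (R : realType) (T : topologicalType) (x y : T -> R) (a b c : R) :
  continuous x -> continuous y -> (forall z, y z != 0) ->
  continuous (fun z => (a * (x z * x z + y z * y z) + b * x z + c) / y z).
Proof.
move=> cx cy y0 z; apply: cvgM; last by apply: cvgV; [exact: y0 | exact: cy].
apply: cvgD; last exact: cvg_cst.
apply: cvgD; (apply: cvgM; first exact: cvg_cst); last exact: cx.
by apply: cvgD; apply: cvgM; solve [exact: cx | exact: cy].
Qed.

Section disk_height.
Variables (R : realType) (D : schottky R).
Local Notation letter := ('I_(sch_q D) * bool)%type.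
Implicit Types (k l m : letter) (M N W : SL2 R) (z : Hplane R).

Definition disk_height k z : R :=
  (side_form k (complex.Re (val z), 1) + complex.Im (val z) ^+ 2 * side_form k (1, 0)) /
    complex.Im (val z).

Lemma disk_height_base k M : disk_height k (act_H (psl M) (base_i R)) = side_height k M.
Proof.
have y0 := lt0r_neq0 (Hplane_gt0 (act_H (psl M) (base_i R))).
have := side_height_point k 1%g M; cbv zeta.
by rewrite mul1g !mv1 /disk_height => <-; rewrite mulfK.
Qed.

Lemma disk_height_continuous k W :
  continuous (fun z => disk_height k (act_H (psl W) z)).
Proof.
have [a [b [c abc]]] := side_form_mv_coef k W.
pose x z := complex.Re (val z : Cplx R); pose y z := complex.Im (val z : Cplx R).
have y0 z : y z != 0 by apply: lt0r_neq0; exact: Hplane_gt0.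
rewrite (_ : (fun _ => _) = fun z => (a * (x z * x z + y z * y z) + (2 * b) * x z + c) / y z).
  have cx : continuous x := @Re_continuous R; have cy : continuous y := @Im_continuous R.
  exact: rational_continuous.
apply/funext => z; have [M zM] := act_H_base_transitive z.
have := side_height_point k W M; cbv zeta; rewrite -zM -/(x z) -/(y z) !abc => e.
rewrite zM -act_HM -pslM disk_height_base -zM; apply: (mulIf (y0 z)).
rewrite e -/(y z) divfK //=; ring.
Qed.

End disk_height.

(** * Products *)

Section product_sections.
Variables (R : realType) (r : nat) (D : 'I_r -> schottky R).
Implicit Types (M N : 'I_r -> SL2 R) (t : 'I_r -> R) (j : 'I_r).

Let Gamma j := schottky_group (D j).

Definition psl_family M : prodG R r := fun j => psl (M j).

(** Chambers are handled through families of matrix lifts, so that the results on crossings apply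
    factor by factor. *)
Definition mat_chamber M : chambers (prod_set Gamma) := chamber (prod_set Gamma) (psl_family M).

Lemma psl_family_surj (g : prodG R r) : exists M, g = psl_family M.
Proof. by exists (fun j => repr (g j)); apply/funext => j; rewrite /psl_family pslK. Qed.

Lemma mat_chamber_surj (x : chambers (prod_set Gamma)) : exists M, x = mat_chamber M.
Proof.
have [M e] := psl_family_surj (repr x); exists M.
by rewrite /mat_chamber -e /chamber orbit_reprK.
Qed.

Lemma prod_set1 : prod_set Gamma 1%g.
Proof. by move=> j; exact: schottky_group1. Qed.

Lemma prod_setM g h : prod_set Gamma g -> prod_set Gamma h -> prod_set Gamma (g * h)%g.
Proof. by move=> Gg Gh j; exact: schottky_groupM (Gg j) (Gh j). Qed.

Lemma prod_setV g : prod_set Gamma g -> prod_set Gamma g^-1%g.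
Proof. by move=> Gg j; exact: schottky_groupV (Gg j). Qed.

Lemma factor_pi_eq j g h : factor_pi Gamma j g = factor_pi Gamma j h <->
  exists2 c, Gamma j c & h = (c * g)%g.
Proof.
apply: (@orbit_piE (PSL2 R) (PSL2 R)).
- exact: mul1g.
- by move=> a b x; rewrite mulgA.
- exact: schottky_group1.
- exact: schottky_groupM.
- exact: schottky_groupV.
Qed.

Lemma chamber_eq (g h : prodG R r) :
  chamber (prod_set Gamma) g = chamber (prod_set Gamma) h <->
  forall j, exists2 c, Gamma j c & h j = (c * g j)%g.
Proof.
rewrite /chamber (@orbit_piE (prodG R r) (prodG R r)).
- split=> [[c Gc ->] j|ch]; first by exists (c j).
  exists (h * g^-1)%g; last by rewrite /prodG_lmul mulgVK.
  by move=> j; have [c Gc hc] := ch j; rewrite -[(h * g^-1)%g j]/(h j * (g j)^-1)%g hc mulgK.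
- exact: mul1g.
- by move=> a b x; rewrite /prodG_lmul mulgA.
- exact: prod_set1.
- exact: prod_setM.
- exact: prod_setV.
Qed.

Lemma mat_chamber_eq M N : mat_chamber M = mat_chamber N <->
  forall j, exists w, psl (N j) = psl (word (D := D j) w * M j)%g.
Proof.
rewrite /mat_chamber chamber_eq; split=> h j; have := h j.
  by move=> [c /schottky_groupP[w _ ->] e]; exists w; rewrite pslM.
by move=> [w e]; exists (psl (word w)); [exact: schottky_group_word | rewrite -pslM].
Qed.

Lemma flow_mat_chamber t M :
  flow (weyl_a t) (mat_chamber M) = mat_chamber (fun j => M j * geod (t j))%g.
Proof.
rewrite flow_chamber; congr chamber; apply/funext => j.
by rewrite /psl_family pslM.
Qed.

Lemma prod_quot_mat (S : forall j : 'I_r, set (PSL2 R)) x :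
  prod_quot_set (fun j => factor_pi Gamma j @` S j) x <->
  exists2 N, x = mat_chamber N & forall j, S j (psl (N j)).
Proof.
split=> [[g hg <-]|[N -> hN]]; last by exists (psl_family N) => // j; exists (psl (N j)).
have h j : exists s, S j s /\ exists2 c, Gamma j c & g j = (c * s)%g.
  by have [s Ss /factor_pi_eq sg] := hg j; exists s.
have [s hs] := choice h; exists (fun j => repr (s j)).
  by apply/esym/chamber_eq => j; rewrite /psl_family pslK; exact: (hs j).2.
by move=> j; rewrite pslK; exact: (hs j).1.
Qed.

Let Chat := prod_quot_set (fun j => factor_pi Gamma j @` sectionC (D j)).
Let Csthat := prod_quot_set (fun j => factor_pi Gamma j @` sectionCst (D j)).

Lemma ChatP x : Chat x <-> exists2 M, x = mat_chamber M & forall j, crossing (D j) (M j).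
Proof.
rewrite /Chat prod_quot_mat; split=> -[M -> hM]; exists M => // j.
  exact/sectionC_crossing.
exact/sectionC_crossing.
Qed.

Lemma Chat_mat M : Chat (mat_chamber M) <->
  forall j, exists w, crossing (D j) (word (D := D j) w * M j)%g.
Proof.
split=> [[g hg gM] j|hM].
  have /chamber_eq/(_ j)[c /schottky_groupP[w _ ->] e] := esym gM.
  have [s Cs /factor_pi_eq[d /schottky_groupP[w' _ ->]]] := hg j.
  move=> e2; exists (rev (map (@opp R (D j)) w') ++ w).
  apply/sectionC_crossing; rewrite word_cat -word_inv -mulgA !pslM pslV.
  by rewrite -[psl (M j)]/(psl_family M j) -e e2 mulKg.
apply/ChatP; have [w hw] : {w : forall j, seq ('I_(sch_q (D j)) * bool) &
    forall j, crossing (D j) (word (w j) * M j)%g}.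
  by exists (fun j => projT1 (cid (hM j))) => j; exact: projT2 (cid (hM j)).
exists (fun j => word (w j) * M j)%g => //; apply/mat_chamber_eq => j.
by exists (w j).
Qed.

Lemma sectionCst_mat (E : schottky R) (A : SL2 R) :
  sectionCst E (psl A) <-> crossing E A /\ infinite_itin E (col1 A).
Proof.
split=> [[/sectionC_crossing ? /limit_set_itin]|[? ?]] //.
by split; [exact/sectionC_crossing | exact/limit_set_itin].
Qed.

Lemma CsthatP x : Csthat x <-> exists2 M, x = mat_chamber M &
  forall j, crossing (D j) (M j) /\ infinite_itin (D j) (col1 (M j)).
Proof.
rewrite /Csthat prod_quot_mat; split=> -[M -> hM]; exists M => // j.
  exact/sectionCst_mat.
exact/sectionCst_mat.
Qed.

Lemma Csthat_sub_Chat : Csthat `<=` Chat.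
Proof. by move=> x /CsthatP[M -> hM]; apply/ChatP; exists M => // j; exact: (hM j).1. Qed.

Lemma representatives_Csthat :
  representatives (prod_set (fun j => sectionCst (D j))) Csthat.
Proof.
split=> [g hg|g h /set_mem hg /set_mem hh|x /CsthatP[M -> hM]].
- by exists g => // j; exists (g j).
- have [M gM] := psl_family_surj g; have [N hN] := psl_family_surj h.
  rewrite gM hN => /mat_chamber_eq e; apply/funext => j.
  have [w ew] := e j; have := hg j; have := hh j.
  rewrite gM hN /psl_family ew => /sectionCst_mat[cwM _] /sectionCst_mat[cM _].
  by rewrite (crossing_unique cM cwM) mul1g.
- by exists (psl_family M) => // j; exact/sectionCst_mat.
Qed.

(** The neighbourhood is the preimage under [entry_sq] of the interval from e^-eps to e^eps in the
    j-th factor. *)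
Lemma weylA_near_coord j (eps : R) : 0 < eps -> within (@weylA R r)
  (nbhs (1%g : prodG R r)) [set a | forall t, a = weyl_a t -> `|t j| < eps].
Proof.
move=> eps0; have e2 (a : R) : entry_sq (psl_diag a) = expR a.
  rewrite /psl_diag entry_sq_psl /= !mxE /= mulr1n expr2 -expRD -splitr //.
have cj : continuous (fun a : prodG R r => entry_sq (a j)).
  move=> a; apply: (@continuous_comp _ _ _ (fun a : prodG R r => a j) (@entry_sq R)).
    exact: (@proj_continuous _ (fun _ : 'I_r => PSL2 R)).
  exact: entry_sq_continuous.
have e1 : entry_sq ((1%g : prodG R r) j) = 1.
  have -> : (1%g : prodG R r) j = psl_diag 0.
    rewrite /psl_diag; congr psl; apply/val_inj/matrixP => a b.
    by rewrite !mxE mul0r oppr0 expR0; case: ifP.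
  by rewrite e2 expR0.
have U1 : nbhs (1 : R) `]expR (- eps), expR eps[%classic.
  apply: open_nbhs_nbhs; split; first exact: interval_open.
  by rewrite /= in_itv /= expR_gt1 expR_lt1 oppr_lt0 eps0.
rewrite -e1 in U1; have := cj (1%g : prodG R r) _ U1 => nU.
apply: (@filterS _ _ (@nbhs_filter (prodG R r) _) _ _ _ nU) => a ha _ t at_.
move: ha; rewrite /= at_ in_itv /= e2 !ltr_expR.
by rewrite ltr_norml.
Qed.

(** One factor suffices: regularity makes its time nonzero, and a small nonzero time moves a
    crossing into a translate of the open fundamental domain. *)
Lemma Chat_discrete x : (0 < r)%N -> Chat x -> discrete_intersection Chat x.
Proof.
move=> r0 /ChatP[M -> hM]; pose j := Ordinal r0.
have [eps eps0 heps] := crossing_discrete (hM j).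
exists [set a | forall t, a = weyl_a t -> `|t j| < eps].
split; first exact: weylA_near_coord.
move=> a Ua [t /(_ j) tj ta]; rewrite -ta flow_mat_chamber => /Chat_mat/(_ j)[w].
have [w0 hw0] := heps (t j) (Ua t (esym ta)) tj.
exact: not_crossing hw0 w.
Qed.

Lemma return_times_mat M t : return_times Chat (mat_chamber M) t <->
  (forall j, 0 < t j) /\
  forall j, exists w, crossing (D j) (word (D := D j) w * (M j * geod (t j)))%g.
Proof. by rewrite /return_times /= flow_mat_chamber Chat_mat. Qed.

(** The return times form a product of sets, one per factor, so the coordinatewise minima are
    attained simultaneously. *)
Lemma first_return_next M t0 : (forall j, crossing (D j) (M j)) ->
  (forall j, exists l, next_side (D := D j) (M j) l (t0 j)) ->
  first_return_time Chat (mat_chamber M) t0.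
Proof.
move=> hM h0; have t0_gt0 j : 0 < t0 j by have [l []] := h0 j.
have t0_ret : return_times Chat (mat_chamber M) t0.
  apply/return_times_mat; split=> // j; have [l [_ _ cl _]] := h0 j.
  by exists [:: opp l]; rewrite /= mulg1.
split=> //; first by exists t0; exact: t0_ret.
  move=> j; split; first by exists t0.
  move=> _ [t /return_times_mat[tpos ht] <-]; rewrite leNgt; apply/negP => tlt.
  have [l [_ _ _ hl]] := h0 j; have [w cw] := ht j.
  apply: (@not_crossing _ (D j) [::] (M j * geod (t j))%g _ w cw) => m.
  by rewrite mul1g; apply: hl; rewrite tpos.
exact: t0_ret.2.
Qed.

(** A return time excludes [crossing_last] in every factor, so each forward endpoint lies in an open
    disk and [crossing_next] applies; two vectors of coordinatewise minima agree. *)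
Lemma first_return_time_next M t0 : (forall j, crossing (D j) (M j)) ->
  first_return_time Chat (mat_chamber M) t0 ->
  forall j, exists l, next_side (D := D j) (M j) l (t0 j).
Proof.
move=> hM [[t /return_times_mat[tpos ht]] t0_min _ t0_ret].
have h j : exists T, exists l, next_side (D := D j) (M j) l T.
  have [[l lv]|nl] := pselect (exists l : 'I_(sch_q (D j)) * bool, side_form l (col1 (M j)) < 0).
    by have [T hT] := crossing_next (hM j) lv; exists T, l.
  have [w cw] := ht j; exfalso.
  apply: (@not_crossing _ (D j) [::] (M j * geod (t j))%g _ w cw) => m.
  rewrite mul1g; apply: crossing_last => // l; rewrite leNgt; apply/negP => lv.
  by apply: nl; exists l.
have [T hT] := choice h.
have [ret1 min1 _ T_ret] := first_return_next hM hT.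
suff -> : t0 = T by [].
apply/funext => j; apply/eqP; rewrite eq_le; apply/andP; split.
  apply: (t0_min j).2; exists T => //; split=> // i; have [l []] := hT i; by [].
by apply: (min1 j).2; have [] := t0_min j.
Qed.

Lemma itin_geod (E : schottky R) n (A B : SL2 R) s :
  itin E n (col1 (A * (B * geod s))%g) <-> itin E n (mv A (col1 B)).
Proof.
have e0 : expR (s / 2) != 0 by rewrite gt_eqF // expR_gt0.
rewrite col1M col1_geod mvZ; split=> h; last exact: itinZ.
have ei : (expR (s / 2))^-1 != 0 by rewrite invr_eq0.
by have := itinZ ei h; rewrite /= !mulKf // -surjective_pairing.
Qed.

(** Each return supplies the first letter of the itinerary in every factor, so n returns give
    itineraries of length n. *)
Lemma first_return_mat M y : (forall j, crossing (D j) (M j)) ->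
  first_return Chat (mat_chamber M) y -> exists N, [/\ y = mat_chamber N,
    forall j, crossing (D j) (N j) &
    forall j n, itin (D j) n (col1 (N j)) -> itin (D j) n.+1 (col1 (M j))].
Proof.
move=> hM [_ [t0 /(first_return_time_next hM) h0 ->]].
pose l j := projT1 (cid (h0 j)); have hl j := projT2 (cid (h0 j)).
exists (fun j => side_map (opp (l j)) * (M j * geod (t0 j)))%g; split.
- rewrite flow_mat_chamber; apply/mat_chamber_eq => j.
  by exists [:: opp (l j)]; rewrite /= mulg1.
- by move=> j; have [] := hl j.
- by move=> j n /itin_geod h; have [lv _ _ _] := hl j; exists (l j).
Qed.

Lemma first_return_infinite M : (forall j, crossing (D j) (M j)) ->
  (forall j, infinite_itin (D j) (col1 (M j))) ->
  exists N, [/\ first_return Chat (mat_chamber M) (mat_chamber N),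
    forall j, crossing (D j) (N j) & forall j, infinite_itin (D j) (col1 (N j))].
Proof.
move=> hM iM; have h0 j : exists T, exists l, next_side (D := D j) (M j) l T.
  have [l lv] := infinite_itin_letter (iM j).
  by have [T hT] := crossing_next (hM j) lv; exists T, l.
have [T hT] := choice h0.
pose l j := projT1 (cid (hT j)); have hl j := projT2 (cid (hT j)).
exists (fun j => side_map (opp (l j)) * (M j * geod (T j)))%g; split.
- split; first by apply/ChatP; exists M.
  exists T; first exact: first_return_next.
  rewrite flow_mat_chamber; apply/esym/mat_chamber_eq => j.
  by exists [:: opp (l j)]; rewrite /= mulg1.
- by move=> j; have [] := hl j.
- move=> j n; apply/itin_geod; have [lv _ _ _] := hl j.
  exact: infinite_itin_next (col1_neq0 _) lv (iM j) n.
Qed.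

(** [iter_first_return] recurses on the last return, whereas itineraries are read from the first. *)
Lemma iter_first_return_head (S : set (chambers (prod_set Gamma))) n x y :
  iter_first_return S n.+1 x y <->
  exists2 z, first_return S x z & iter_first_return S n z y.
Proof.
elim: n y => [|n IH] y.
  split=> [[_ [Sx ->] xy]|[z xz [Sz ->]]]; last by exists x => //; split=> //; case: xz.
  exists y => //; split=> //; case: xy => _ [t [_ _ _ St] ->]; exact: St.
split=> [[z /IH[u xu uz] zy]|[u xu [z uz zy]]].
  by exists u => //; exists z.
by exists z => //; apply/IH; exists u.
Qed.

Lemma Csthat_infinite_returns : Csthat = infinite_returns Chat.
Proof.
apply/seteqP; split=> [x Cx|x [/ChatP[M -> hM] iters]].
  split=> [|n]; first exact: Csthat_sub_Chat.
  move/CsthatP: (Cx) => [M xM hM].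
  suff [N [ret _]] : exists N, iter_first_return Chat n x (mat_chamber N) /\
    forall j, crossing (D j) (N j) /\ infinite_itin (D j) (col1 (N j)).
    by exists (mat_chamber N).
  elim: n => [|n [N [ret hN]]].
    by exists M; split=> //; split=> //; exact: Csthat_sub_Chat.
  have [P [fr cP iP]] := first_return_infinite (fun j => (hN j).1) (fun j => (hN j).2).
  by exists P; split=> //; exists (mat_chamber N).
apply/CsthatP; exists M => // j; split=> // n.
have {iters} [y] := iters n.
elim: n M hM => //= n IH M hM /iter_first_return_head[z xz zy].
have [N [zN cN iN]] := first_return_mat hM xz.
by apply: iN; apply: IH => //; rewrite -zN.
Qed.

(** * Compact flats *)

Lemma geodD (s t : R) : (geod s * geod t)%g = geod (s + t).
Proof.
apply/val_inj; rewrite /= mulmx_diag; congr diag_mx; apply/rowP => j.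
by rewrite !mxE mulrDl opprD; case: ifP => _; rewrite -expRD.
Qed.

Definition bounded_heights j (n : R) : set (prodH R r) :=
  [set z | forall k : 'I_(sch_q (D j)) * bool, `|disk_height k (z j)| < n].

Lemma open_bounded_heights j n c : prod_set Gamma c ->
  open ((@act_prodH R r c) @^-1` bounded_heights j n).
Proof.
move=> /(_ j)/schottky_groupP[w _ cw]; rewrite openE => z hz.
apply: (@filter_forall _ _ _ _ (@nbhs_filter (prodH R r) z)) => k.
pose f (z : prodH R r) := disk_height k (act_H (psl (word w)) (z j)).
have cf : continuous f.
  move=> y; apply: (@continuous_comp _ _ _ (fun z : prodH R r => z j)
    (fun y => disk_height k (act_H (psl (word w)) y))).
    exact: (@proj_continuous _ (fun _ : 'I_r => Hplane R)).
  exact: disk_height_continuous.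
have fz : `|f z| < n by have := hz k; rewrite /act_prodH cw.
have U1 : nbhs (f z) [set x | `|x| < n].
  apply: open_nbhs_nbhs; split => //; apply: (@open_comp _ _ (@Num.norm _ R) [set x | x < n]).
    by move=> x _; exact: norm_continuous.
  exact: open_lt.
apply: (@filterS _ _ (@nbhs_filter (prodH R r) _) _ _ _ (cf z _ U1)) => y.
by rewrite /= /act_prodH cw.
Qed.

Lemma act_prodH1 (x : prodH R r) : act_prodH 1%g x = x.
Proof.
apply/funext => j; rewrite /act_prodH.
by have [M ->] := act_H_base_transitive (x j); rewrite -act_HM mul1g.
Qed.

Lemma act_prodHM (g h : prodG R r) (x : prodH R r) :
  act_prodH (g * h)%g x = act_prodH g (act_prodH h x).
Proof. by apply/funext => j; rewrite /act_prodH -act_HM. Qed.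

(** The images of the regions of bounded height form an increasing open cover of the quotient, one
    of whose members contains the compact set. *)
Lemma compact_bounded_heights j (K : set (quotY (prod_set Gamma))) : compact K ->
  exists n : R, K `<=`
    orbit_pi (@act_prodH R r) (prod_set Gamma) @` bounded_heights j n.
Proof.
move=> /compact_near_coveringP cK.
pose V n : set (quotY (prod_set Gamma)) :=
  orbit_pi (@act_prodH R r) (prod_set Gamma) @` bounded_heights j n%:R.
have oV n : open (V n).
  apply: (open_orbit_saturation act_prodH1 act_prodHM prod_set1 prod_setM prod_setV).
  by move=> c; exact: open_bounded_heights.
have VS m n : (m <= n)%N -> V m `<=` V n.
  move=> mn _ [z hz <-]; exists z => // k; apply: lt_le_trans (hz k) _.
  by rewrite ler_nat.
have [x Kx|N _ hN] := cK nat \oo V _.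
  rewrite -[x]orbit_reprK; set z := repr x.
  have [H H0 hH] := finite_upper_bound (fun k : 'I_(sch_q (D j)) * bool =>
    `|disk_height k (z j)|) 0.
  have [n hn] : exists n : nat, H < n%:R.
    by exists (Num.bound H); apply: archi_boundP; exact: ltW.
  exists (V n, [set m | (n <= m)%N]).
    split => /=; last by exists n.
    apply: open_nbhs_nbhs; split; first exact: oV.
    by exists z => // k; apply: lt_trans (hH k) hn.
  by move=> [y m] /= [Vy nm]; exact: VS nm _ Vy.
by exists N%:R; exact: hN N (leqnn N).
Qed.

Lemma compact_flat_itin M F : F = flat_through (mat_chamber M) ->
  compact (underlying_flat F) -> forall j, infinite_itin (D j) (col1 (M j)).
Proof.
move=> FM cF j; have [//|niM] := pselect (infinite_itin (D j) (col1 (M j))); exfalso.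
have [n hn] := compact_bounded_heights j cF.
have [s hs] := not_infinite_itin_ray n niM.
(* All factors flow for the same time [s], although only the j-th one has to escape. *)
pose N i := (M i * geod s)%g.
have /hn[z hz] : underlying_flat F (orbit_pi (@act_prodH R r) (prod_set Gamma)
    (act_prodH (psl_family N) (@origin R r))).
  exists (psl_family N) => //; rewrite FM; exists (weyl_a (fun=> s)); first by exists (fun=> s).
  exact: flow_mat_chamber.
move=> /esym/(orbit_piE act_prodH1 act_prodHM prod_set1 prod_setM prod_setV)[c Gc zE].
have /schottky_groupP[w _ cw] := Gc j; have [k hk] := hs w.
have := hz k; rewrite zE /act_prodH cw /psl_family -act_HM -pslM disk_height_base.
by rewrite ltNge hk.
Qed.

Lemma compact_flat_Csthat F : compact_flat F -> exists x, intersects_in F Csthat x.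
Proof.
move=> [[y ->]]; have [M ->] := mat_chamber_surj y => cF.
have h j := infinite_itin_crossing (compact_flat_itin erefl cF j).
pose w j := projT1 (cid (h j)); have /choice[t ht] j := projT2 (cid (h j)).
pose N j := (word (w j) * M j * geod (t j))%g.
have NE : mat_chamber N = flow (weyl_a t) (mat_chamber M).
  rewrite flow_mat_chamber; apply/esym/mat_chamber_eq => j.
  by exists (w j); rewrite mulgA.
exists (mat_chamber N); split; first by apply/CsthatP; exists N.
(* The new base point lies on the same orbit of the flow, so the two parametrisations of the flat
   differ by the shift [t]. *)
rewrite NE flow_mat_chamber; apply/seteqP; split=> _ [_ [s _ <-] <-].
  exists (weyl_a (fun j => t j + s j)); first by exists (fun j => t j + s j).
  rewrite !flow_mat_chamber; congr mat_chamber; apply/funext => j.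
  by rewrite -mulgA geodD.
exists (weyl_a (fun j => s j - t j)); first by exists (fun j => s j - t j).
rewrite !flow_mat_chamber; congr mat_chamber; apply/funext => j.
by rewrite -mulgA geodD addrC subrK.
Qed.

Lemma Csthat_strong (r_gt0 : (0 < r)%N) : strong_cross_section_in Chat Csthat.
Proof.
have sub_discrete x : Csthat x -> discrete_intersection Csthat x.
  move=> /Csthat_sub_Chat/(Chat_discrete r_gt0)[U [nU hU]]; exists U; split=> // a Ua ra.
  by move=> /Csthat_sub_Chat; exact: hU.
split.
- split=> [F /compact_flat_Csthat[x [Cx Fx]]|F x _ [Cx _]].
    by exists x; split=> //; exact: Csthat_sub_Chat.
  exact: Chat_discrete.
- exact: Csthat_infinite_returns.
- split=> [F|F x _ [Cx _]]; first exact: compact_flat_Csthat.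
  exact: sub_discrete.
Qed.

End product_sections.

Theorem theorem4p2 (R : realType) (r : nat) (r_gt0 : (0 < r)%N)
    (D : 'I_r -> schottky R) :
  let Gamma := fun j : 'I_r => schottky_group (D j) in
  let C := fun j : 'I_r => sectionC (D j) in
  let Cst := fun j : 'I_r => sectionCst (D j) in
  let Chat := prod_quot_set (fun j : 'I_r => factor_pi Gamma j @` C j) in
  let Csthat := prod_quot_set (fun j : 'I_r => factor_pi Gamma j @` Cst j) in
  strong_cross_section_in Chat Csthat /\
  representatives (prod_set Cst) Csthat.
Proof. by split; [exact: Csthat_strong | exact: representatives_Csthat]. Qed.
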